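(* Let $M$ be an open subset of the Euclidean plane, with Euclidean coordinates $(x,y)$, and let $(u,v)$ be the corresponding fibre coordinates on the slit tangent bundle $T^\circ M$. In order that a Finsler metric of Randers type on $M$ whose Riemannian part is conformal to the Euclidean metric, that is, a Finsler metric of the form $$F(x,y,u,v)=e^{\phi(x,y)}\sqrt{u^2+v^2}+a(x,y)u+b(x,y)v,$$ should have only circles as geodesics, the Riemannian part must be of constant Gaussian curvature. Up to a Möbius transformation, and up to multiplication by a positive constant and the addition of an arbitrary total derivative, such a Finsler metric (one having only circles as geodesics) belongs to one of the following three one-parameter families (with parameter $\tau$) of Randers metrics, for which the Gaussian curvature of the Riemannian part is respectively $0$, $+1$ and $-1$: $$F_\tau(x,y,u,v)=\sqrt{u^2+v^2}+\tau(yu-xv),$$ $$F_\tau(x,y,u,v)=\frac{\sqrt{u^2+v^2}+\tau(yu-xv)}{2(1+(x^2+y^2))},$$ $$F_\tau(x,y,u,v)=\frac{\sqrt{u^2+v^2}+\tau(yu-xv)}{2(1-(x^2+y^2))}.$$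
   Context: The slit tangent bundle $T^\circ M$ is the tangent bundle of $M$ with the zero section removed. A Finsler metric (Finsler function) on $M$ is a smooth function $F$ on $T^\circ M$, positively homogeneous of degree 1 in $(u,v)$, that is positive and strongly convex. It is of Randers type if it is the sum of the norm function of a Riemannian metric (its Riemannian part) and a function linear in $(u,v)$, i.e. a 1-form on $M$. In the displayed form of $F$, $\phi,a,b$ are smooth functions on $M$, and the Riemannian part is $e^{\phi}\sqrt{u^2+v^2}$, the norm of the Riemannian metric $e^{2\phi}(dx^2+dy^2)$. Geodesics of $F$ are the solutions of its Euler-Lagrange equations, considered as oriented paths (parametrization is disregarded). ''Circle'' is meant in the ordinary Euclidean sense (arcs included), with straight lines counted as circles of infinite radius. A total derivative is a function of the form $\frac{\partial\psi}{\partial x}u+\frac{\partial\psi}{\partial y}v$ for some function $\psi$ on $M$; adding one does not change the Euler-Lagrange equations. Möbius transformations are the transformations of the plane which map circles to circles (inversion in a circle included); they are conformal for the Euclidean metric.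
   Formalization: The conclusion is stated on each connected open part of M; the total derivative is asserted on simply connected open subsets (it can fail globally on an annulus); the curvatures 0, +1, -1 are stated for 4F_τ, as the displayed second and third families have curvature +16 and -16. *)

(* Defs.v *)
From Stdlib Require Import Reals.
From Coquelicot Require Import Coquelicot.
Open Scope R_scope.

(* Functions on the tangent bundle of the plane are written F x y u v. *)

Definition d_x (f : R -> R -> R) (x y : R) : R := Derive (fun z => f z y) x.
Definition d_y (f : R -> R -> R) (x y : R) : R := Derive (fun z => f x z) y.

Definition smooth_on (D : R * R -> Prop) (f : R -> R -> R) : Prop :=
  forall n x y, D (x, y) -> ex_diff_n f n x y.

Definition pd1 (F : R -> R -> R -> R -> R) x y u v : R := Derive (fun z => F z y u v) x.
Definition pd2 (F : R -> R -> R -> R -> R) x y u v : R := Derive (fun z => F x z u v) y.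
Definition pd3 (F : R -> R -> R -> R -> R) x y u v : R := Derive (fun z => F x y z v) u.
Definition pd4 (F : R -> R -> R -> R -> R) x y u v : R := Derive (fun z => F x y u z) v.

Fixpoint Ck_on (n : nat) (D : R -> R -> R -> R -> Prop)
    (F : R -> R -> R -> R -> R) : Prop :=
  (forall x y u v, D x y u v ->
     continuous (fun p : R * R * R * R =>
       F (fst (fst (fst p))) (snd (fst (fst p))) (snd (fst p)) (snd p)) (x, y, u, v))
  /\ match n with
     | O => True
     | S m =>
         (forall x y u v, D x y u v ->
            ex_derive (fun z => F z y u v) x /\ ex_derive (fun z => F x z u v) y /\
            ex_derive (fun z => F x y z v) u /\ ex_derive (fun z => F x y u z) v)
         /\ Ck_on m D (pd1 F) /\ Ck_on m D (pd2 F) /\ Ck_on m D (pd3 F) /\ Ck_on m D (pd4 F)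
     end.

Definition slit_tangent (M : R * R -> Prop) (x y u v : R) : Prop :=
  M (x, y) /\ (u, v) <> (0, 0).

(* Strong convexity: the fundamental tensor, i.e. the fibre Hessian of F^2/2,
   is positive definite at every point of the slit tangent bundle. *)
Definition strongly_convex_at (F : R -> R -> R -> R -> R) (x y u v : R) : Prop :=
  let E := fun x y u v => / 2 * (F x y u v) ^ 2 in
  forall p q, (p, q) <> (0, 0) ->
    0 < pd3 (pd3 E) x y u v * p ^ 2
        + (pd3 (pd4 E) x y u v + pd4 (pd3 E) x y u v) * (p * q)
        + pd4 (pd4 E) x y u v * q ^ 2.

Definition finsler (M : R * R -> Prop) (F : R -> R -> R -> R -> R) : Prop :=
  (forall n, Ck_on n (slit_tangent M) F) /\
  (forall x y u v k, slit_tangent M x y u v -> 0 < k ->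
     F x y (k * u) (k * v) = k * F x y u v) /\
  (forall x y u v, slit_tangent M x y u v -> 0 < F x y u v) /\
  (forall x y u v, slit_tangent M x y u v -> strongly_convex_at F x y u v).

Definition randers (phi a b : R -> R -> R) (x y u v : R) : R :=
  exp (phi x y) * sqrt (u ^ 2 + v ^ 2) + a x y * u + b x y * v.

(* A geodesic on the open interval ]t0, t1[: a regular C^2 curve in M solving the
   Euler-Lagrange equations of F. As F is homogeneous of degree 1, the solutions
   are invariant under orientation-preserving reparametrization; bounded parameter
   intervals therefore cover all oriented paths. *)
Definition geodesic (M : R * R -> Prop) (F : R -> R -> R -> R -> R)
    (t0 t1 : R) (x y : R -> R) : Prop :=
  forall t, t0 < t < t1 ->
    slit_tangent M (x t) (y t) (Derive x t) (Derive y t) /\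
    (ex_derive x t /\ ex_derive (Derive x) t /\ continuous (Derive (Derive x)) t) /\
    (ex_derive y t /\ ex_derive (Derive y) t /\ continuous (Derive (Derive y)) t) /\
    is_derive (fun s => pd3 F (x s) (y s) (Derive x s) (Derive y s)) t
              (pd1 F (x t) (y t) (Derive x t) (Derive y t)) /\
    is_derive (fun s => pd4 F (x s) (y s) (Derive x s) (Derive y s)) t
              (pd2 F (x t) (y t) (Derive x t) (Derive y t)).

(* The extended plane; None is the point at infinity. *)
Definition xplane : Type := option (R * R).

(* Circles of the extended plane: Euclidean circles, and straight lines
   completed by the point at infinity. *)
Definition circle (C : xplane -> Prop) : Prop :=
  (exists x0 y0 r, 0 < r /\
     forall P, C P <-> match P with
                       | Some (x, y) => (x - x0) ^ 2 + (y - y0) ^ 2 = r ^ 2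
                       | None => False
                       end) \/
  (exists p q c, (p, q) <> (0, 0) /\
     forall P, C P <-> match P with
                       | Some (x, y) => p * x + q * y = c
                       | None => True
                       end).

Definition only_circles_as_geodesics (M : R * R -> Prop)
    (F : R -> R -> R -> R -> R) : Prop :=
  forall t0 t1 x y, t0 < t1 -> geodesic M F t0 t1 x y ->
    exists C, circle C /\ forall t, t0 < t < t1 -> C (Some (x t, y t)).

Definition moebius (m : xplane -> xplane) : Prop :=
  (exists m' : xplane -> xplane, (forall P, m' (m P) = P) /\ (forall P, m (m' P) = P)) /\
  (forall C, circle C -> circle (fun Q => exists P, C P /\ m P = Q)).

(* F evaluated on the image of (x, y, u, v) under the tangent map of (m1, m2). *)
Definition pullback (m1 m2 : R -> R -> R) (F : R -> R -> R -> R -> R)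
    (x y u v : R) : R :=
  F (m1 x y) (m2 x y)
    (d_x m1 x y * u + d_y m1 x y * v) (d_x m2 x y * u + d_y m2 x y * v).

Definition total_derivative (psi : R -> R -> R) (x y u v : R) : R :=
  d_x psi x y * u + d_y psi x y * v.

(* Gaussian curvature of a Riemannian metric g_ij on the plane, by way of its
   Levi-Civita connection. Indices range over bool: false is x, true is y. *)
Definition metric : Type := bool -> bool -> R -> R -> R.

Definition sum2 (f : bool -> R) : R := f false + f true.
Definition d_ (i : bool) : (R -> R -> R) -> R -> R -> R := if i then d_y else d_x.

Definition gdet (g : metric) (x y : R) : R :=
  g false false x y * g true true x y - g false true x y * g true false x y.

Definition ginv (g : metric) (i j : bool) (x y : R) : R :=
  match i, j with
  | false, false => g true true x y / gdet g x y
  | true, true => g false false x y / gdet g x y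
  | _, _ => - g i j x y / gdet g x y
  end.

(* Gamma^k_ij *)
Definition christoffel (g : metric) (k i j : bool) (x y : R) : R :=
  / 2 * sum2 (fun l => ginv g k l x y *
    (d_ i (g j l) x y + d_ j (g i l) x y - d_ l (g i j) x y)).

(* The l-th component of R(d_i, d_j) d_k. *)
Definition riemann (g : metric) (l i j k : bool) (x y : R) : R :=
  d_ i (christoffel g l j k) x y - d_ j (christoffel g l i k) x y
  + sum2 (fun m => christoffel g m j k x y * christoffel g l i m x y
                   - christoffel g m i k x y * christoffel g l j m x y).

(* g(R(d_x, d_y) d_y, d_x) / det g *)
Definition gauss_curvature (g : metric) (x y : R) : R :=
  sum2 (fun l => g l false x y * riemann g l false true true x y) / gdet g x y.

(* lam^2 (dx^2 + dy^2), whose norm function is lam * sqrt (u^2 + v^2). *)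
Definition conformal_metric (lam : R -> R -> R) : metric :=
  fun i j x y => if Bool.eqb i j then lam x y ^ 2 else 0.

Inductive geometry := flat | spherical | hyperbolic.

Definition family_metric (g : geometry) (tau : R) (x y u v : R) : R :=
  match g with
  | flat => sqrt (u ^ 2 + v ^ 2) + tau * (y * u - x * v)
  | spherical =>
      (sqrt (u ^ 2 + v ^ 2) + tau * (y * u - x * v)) / (2 * (1 + (x ^ 2 + y ^ 2)))
  | hyperbolic =>
      (sqrt (u ^ 2 + v ^ 2) + tau * (y * u - x * v)) / (2 * (1 - (x ^ 2 + y ^ 2)))
  end.

Definition family_domain (g : geometry) (x y : R) : Prop :=
  match g with
  | hyperbolic => x ^ 2 + y ^ 2 < 1
  | _ => True
  end.

(* The Riemannian part of family_metric g tau is family_factor g * sqrt (u^2 + v^2). *)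
Definition family_factor (g : geometry) (x y : R) : R :=
  match g with
  | flat => 1
  | spherical => / (2 * (1 + (x ^ 2 + y ^ 2)))
  | hyperbolic => / (2 * (1 - (x ^ 2 + y ^ 2)))
  end.

Definition family_curvature (g : geometry) : R :=
  match g with flat => 0 | spherical => 1 | hyperbolic => -1 end.

Definition connected (A : R * R -> Prop) : Prop :=
  forall U V : R * R -> Prop, open U -> open V ->
    (forall p, A p -> U p \/ V p) -> (forall p, A p -> ~ (U p /\ V p)) ->
    (forall p, A p -> U p) \/ (forall p, A p -> V p).

(* A path is given by a continuous map on the whole line whose restriction to [0,1]
   matters, and a homotopy by a continuous map on the plane, restricted to the unit
   square; every continuous map on [0,1] or on the square extends. *)
Definition path_in (A : R * R -> Prop) (c : R -> R * R) : Prop :=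
  (forall t, continuous c t) /\ (forall t, 0 <= t <= 1 -> A (c t)).

Definition simply_connected (A : R * R -> Prop) : Prop :=
  (forall p q, A p -> A q -> exists c, path_in A c /\ c 0 = p /\ c 1 = q) /\
  (forall c, path_in A c -> c 0 = c 1 ->
     exists h : R * R -> R * R,
       (forall z, continuous h z) /\
       (forall t s, 0 <= t <= 1 -> 0 <= s <= 1 -> A (h (t, s))) /\
       (forall t, 0 <= t <= 1 -> h (t, 0) = c t /\ h (t, 1) = c 0) /\
       (forall s, 0 <= s <= 1 -> h (0, s) = c 0 /\ h (1, s) = c 0)).

(* Main.v *)
Require Import Defs.
From Stdlib Require Import Reals Lra Lia Classical ClassicalEpsilon.
From Coquelicot Require Import Coquelicot.
Open Scope R_scope.

(** Along a curve of unit Euclidean speed with direction th the Euler-Lagrange equations of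
    F = e^phi |v| + a u + b v say that its curvature is
      ka = phi_y cos th - phi_x sin th - w,   w = e^(- phi) (b_x - a_y)
    (unit_speed_geodesic). By the Cauchy-Lipschitz theorem such a curve starts at every point
    in every direction (prescribed_curvature). If it lies on a circle, then ka is constant
    along it (circle_curvature_constant), so that the derivative of ka vanishes at the
    starting point; this is a trigonometric polynomial in th, whose coefficients give
      phi_xy = phi_x phi_y,   phi_xx - phi_x^2 = phi_yy - phi_y^2,   dw = w dphi
    (circular_geodesics_equations). For mu = e^(- phi) the first two equations read mu_xy = 0
    and mu_xx = mu_yy. On a connected set they force
      mu = A (x^2 + y^2) + B x + C y + D,
    and the third one forces w mu = (b_x - a_y) mu^2 to be a constant T
    (circular_randers_structure). The metric (dx^2 + dy^2) / mu^2 has the constant curvature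
    4 A D - B^2 - C^2 (gauss_curvature_reciprocal_quadratic).

    The domain where mu > 0 is mapped by a similarity or an inversion, composed with a
    similarity, to the domain of one of the three families, in such a way that the
    Riemannian parts correspond up to a constant k (quadratic_normal_form). Both linear parts
    then have as exterior derivative a constant multiple of the area form of the same
    Riemannian metric; with the right tau these agree (randers_normal_form). So the linear
    parts differ by a closed form, which on a simply connected set is exact (poincare). *)

(** * Smooth functions of two variables *)

Lemma open_locally_2d (D : R * R -> Prop) (x y : R) :
  open D -> D (x, y) -> locally_2d (fun u v => D (u, v)) x y.
Proof.
  intros HD Hxy. apply locally_2d_locally.
  generalize (HD (x, y) Hxy). apply filter_imp. intros [u v] H. exact H.
Qed.

Lemma smooth_on_continuity (D : R * R -> Prop) (f : R -> R -> R) (x y : R) :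
  smooth_on D f -> D (x, y) -> continuity_2d_pt f x y.
Proof. intros Hf Hxy. exact (proj1 (Hf O x y Hxy)). Qed.

Lemma smooth_on_is_derive_x (D : R * R -> Prop) (f : R -> R -> R) (x y : R) :
  smooth_on D f -> D (x, y) -> is_derive (fun z => f z y) x (d_x f x y).
Proof.
  intros Hf Hxy. destruct (Hf 1%nat x y Hxy) as (_ & Hx & _).
  now apply Derive_correct.
Qed.

Lemma smooth_on_is_derive_y (D : R * R -> Prop) (f : R -> R -> R) (x y : R) :
  smooth_on D f -> D (x, y) -> is_derive (fun z => f x z) y (d_y f x y).
Proof.
  intros Hf Hxy. destruct (Hf 1%nat x y Hxy) as (_ & _ & Hy & _).
  now apply Derive_correct.
Qed.

Lemma smooth_on_d_x (D : R * R -> Prop) (f : R -> R -> R) :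
  smooth_on D f -> smooth_on D (d_x f).
Proof. intros Hf n x y Hxy. exact (proj1 (proj2 (proj2 (proj2 (Hf (S n) x y Hxy))))). Qed.

Lemma smooth_on_d_y (D : R * R -> Prop) (f : R -> R -> R) :
  smooth_on D f -> smooth_on D (d_y f).
Proof. intros Hf n x y Hxy. exact (proj2 (proj2 (proj2 (proj2 (Hf (S n) x y Hxy))))). Qed.

Lemma smooth_on_subset (D E : R * R -> Prop) (f : R -> R -> R) :
  (forall p, E p -> D p) -> smooth_on D f -> smooth_on E f.
Proof. intros HED Hf n x y Hxy. apply Hf, HED, Hxy. Qed.

(** A family of functions closed under taking partial derivatives consists of smooth
    functions; the closure of the smooth functions under the operations used below is
    such a family, so that all its members are smooth at once. *)
Inductive elementary (D : R * R -> Prop) : (R -> R -> R) -> Prop :=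
| el_smooth f : smooth_on D f -> elementary D f
| el_const c : elementary D (fun _ _ => c)
| el_x : elementary D (fun x _ => x)
| el_y : elementary D (fun _ y => y)
| el_opp f : elementary D f -> elementary D (fun x y => - f x y)
| el_plus f g : elementary D f -> elementary D g -> elementary D (fun x y => f x y + g x y)
| el_mult f g : elementary D f -> elementary D g -> elementary D (fun x y => f x y * g x y)
| el_inv f : elementary D f -> (forall x y, D (x, y) -> f x y <> 0) ->
    elementary D (fun x y => / f x y)
| el_exp f : elementary D f -> elementary D (fun x y => exp (f x y)).

Lemma elementary_partials (D : R * R -> Prop) (f : R -> R -> R) :
  elementary D f ->
  (forall x y, D (x, y) -> continuity_2d_pt f x y) /\
  exists fx fy, elementary D fx /\ elementary D fy /\
    forall x y, D (x, y) ->
      is_derive (fun z => f z y) x (fx x y) /\ is_derive (fun z => f x z) y (fy x y).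
Proof.
  induction 1 as [f Hf | c | | | f Hf [Cf (fx & fy & Ex & Ey & Hd)]
    | f g Hf [Cf (fx & fy & Ex & Ey & Hd)] Hg [Cg (gx & gy & Gx & Gy & Gd)]
    | f g Hf [Cf (fx & fy & Ex & Ey & Hd)] Hg [Cg (gx & gy & Gx & Gy & Gd)]
    | f Hf [Cf (fx & fy & Ex & Ey & Hd)] Hnz | f Hf [Cf (fx & fy & Ex & Ey & Hd)]].
  - split; [intros x y; now apply smooth_on_continuity|].
    exists (d_x f), (d_y f).
    split; [now apply el_smooth, smooth_on_d_x|].
    split; [now apply el_smooth, smooth_on_d_y|].
    intros x y Hxy; split.
    now apply (smooth_on_is_derive_x D). now apply (smooth_on_is_derive_y D).
  - split; [intros x y _; apply continuity_2d_pt_const|].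
    exists (fun _ _ => 0), (fun _ _ => 0).
    split; [apply el_const|split; [apply el_const|]]. intros x y _.
    split; apply (is_derive_const (K := R_AbsRing) (V := R_NormedModule)).
  - split; [intros x y _; apply continuity_2d_pt_id1|].
    exists (fun _ _ => 1), (fun _ _ => 0).
    split; [apply el_const|split; [apply el_const|]]. intros x y _.
    split. apply (is_derive_id (K := R_AbsRing)).
    apply (is_derive_const (K := R_AbsRing) (V := R_NormedModule)).
  - split; [intros x y _; apply continuity_2d_pt_id2|].
    exists (fun _ _ => 0), (fun _ _ => 1).
    split; [apply el_const|split; [apply el_const|]]. intros x y _.
    split. apply (is_derive_const (K := R_AbsRing) (V := R_NormedModule)).
    apply (is_derive_id (K := R_AbsRing)).
  - split; [intros x y Hxy; apply continuity_2d_pt_opp; auto|].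
    exists (fun x y => - fx x y), (fun x y => - fy x y).
    split; [now apply el_opp|split; [now apply el_opp|]].
    intros x y Hxy. destruct (Hd x y Hxy) as [H1 H2].
    split; apply (is_derive_opp (K := R_AbsRing) (V := R_NormedModule)); assumption.
  - split; [intros x y Hxy; apply continuity_2d_pt_plus; auto|].
    exists (fun x y => fx x y + gx x y), (fun x y => fy x y + gy x y).
    split; [now apply el_plus|split; [now apply el_plus|]].
    intros x y Hxy. destruct (Hd x y Hxy) as [H1 H2], (Gd x y Hxy) as [H3 H4].
    split; apply (is_derive_plus (K := R_AbsRing) (V := R_NormedModule)); assumption.
  - split; [intros x y Hxy; apply continuity_2d_pt_mult; auto|].
    exists (fun x y => fx x y * g x y + f x y * gx x y),
      (fun x y => fy x y * g x y + f x y * gy x y).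
    split; [now apply el_plus; apply el_mult|split; [now apply el_plus; apply el_mult|]].
    intros x y Hxy. destruct (Hd x y Hxy) as [H1 H2], (Gd x y Hxy) as [H3 H4].
    split.
    apply (is_derive_mult (fun z => f z y) (fun z => g z y)); auto using Rmult_comm.
    apply (is_derive_mult (fun z => f x z) (fun z => g x z)); auto using Rmult_comm.
  - split; [intros x y Hxy; apply continuity_2d_pt_inv; auto|].
    assert (E : elementary D (fun x y => / f x y)) by now apply el_inv.
    exists (fun x y => - (fx x y * (/ f x y * / f x y))),
      (fun x y => - (fy x y * (/ f x y * / f x y))).
    split; [now apply el_opp, el_mult, el_mult|].
    split; [now apply el_opp, el_mult, el_mult|].
    intros x y Hxy. destruct (Hd x y Hxy) as [H1 H2].
    pose proof (Hnz x y Hxy) as Hn.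
    split.
    + replace (- _) with (- fx x y / f x y ^ 2) by (field; exact Hn).
      apply (is_derive_inv (fun z => f z y)); assumption.
    + replace (- _) with (- fy x y / f x y ^ 2) by (field; exact Hn).
      apply (is_derive_inv (fun z => f x z)); assumption.
  - split.
    { intros x y Hxy. apply continuity_1d_2d_pt_comp; auto.
      apply derivable_continuous_pt, derivable_pt_exp. }
    exists (fun x y => fx x y * exp (f x y)), (fun x y => fy x y * exp (f x y)).
    split; [now apply el_mult; [|apply el_exp]|].
    split; [now apply el_mult; [|apply el_exp]|].
    intros x y Hxy. destruct (Hd x y Hxy) as [H1 H2].
    split.
    + apply (is_derive_comp exp (fun z => f z y)); [apply is_derive_exp|assumption].
    + apply (is_derive_comp exp (fun z => f x z)); [apply is_derive_exp|assumption].
Qed.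

Lemma elementary_smooth (D : R * R -> Prop) (f : R -> R -> R) :
  open D -> elementary D f -> smooth_on D f.
Proof.
  intros HD Hf n. revert f Hf.
  induction n as [|n IH]; intros f Hf x y Hxy;
    destruct (elementary_partials D f Hf) as [Cf (fx & fy & Ex & Ey & Hd)].
  - split; auto.
  - destruct (Hd x y Hxy) as [H1 H2].
    repeat split; auto.
    + eexists; eassumption.
    + eexists; eassumption.
    + apply ex_diff_n_ext_loc with fx; [|now apply IH].
      generalize (open_locally_2d D x y HD Hxy). apply locally_2d_impl, locally_2d_forall.
      intros u v Huv. symmetry. apply is_derive_unique, (Hd u v Huv).
    + apply ex_diff_n_ext_loc with fy; [|now apply IH].
      generalize (open_locally_2d D x y HD Hxy). apply locally_2d_impl, locally_2d_forall.
      intros u v Huv. symmetry. apply is_derive_unique, (Hd u v Huv).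
Qed.

Lemma el_pow (D : R * R -> Prop) (f : R -> R -> R) (n : nat) :
  elementary D f -> elementary D (fun x y => f x y ^ n).
Proof.
  intros Hf. induction n as [|n IH]; simpl.
  - apply el_const.
  - now apply el_mult.
Qed.

Lemma el_minus (D : R * R -> Prop) (f g : R -> R -> R) :
  elementary D f -> elementary D g -> elementary D (fun x y => f x y - g x y).
Proof. intros Hf Hg. apply el_plus; [|apply el_opp]; assumption. Qed.

Lemma smooth_on_differentiable (D : R * R -> Prop) (f : R -> R -> R) (x y : R) :
  open D -> smooth_on D f -> D (x, y) ->
  differentiable_pt_lim f x y (d_x f x y) (d_y f x y).
Proof.
  intros HD Hf Hxy. apply filterdiff_differentiable_pt_lim.
  apply (is_derive_filterdiff f x y (d_x f) (d_y f x y)).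
  - generalize (open_locally_2d D x y HD Hxy). intros H.
    apply locally_2d_locally in H. revert H. apply filter_imp.
    intros [u v] Huv. now apply (smooth_on_is_derive_x D).
  - now apply (smooth_on_is_derive_y D).
  - apply continuity_2d_pt_filterlim.
    apply (smooth_on_continuity D); [now apply smooth_on_d_x|assumption].
Qed.

Lemma is_derive_along_curve (D : R * R -> Prop) (f : R -> R -> R) (X Y : R -> R)
    (t X' Y' : R) :
  open D -> smooth_on D f -> D (X t, Y t) -> is_derive X t X' -> is_derive Y t Y' ->
  is_derive (fun s => f (X s) (Y s)) t (d_x f (X t) (Y t) * X' + d_y f (X t) (Y t) * Y').
Proof.
  intros HD Hf Ht HX HY. apply is_derive_Reals, derivable_pt_lim_comp_2d.
  - now apply (smooth_on_differentiable D).
  - now apply is_derive_Reals.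
  - now apply is_derive_Reals.
Qed.

Lemma smooth_on_mixed_partials (D : R * R -> Prop) (f : R -> R -> R) (x y : R) :
  open D -> smooth_on D f -> D (x, y) -> d_x (d_y f) x y = d_y (d_x f) x y.
Proof.
  intros HD Hf Hxy. apply (Schwarz f x y).
  - generalize (open_locally_2d D x y HD Hxy). apply locally_2d_impl, locally_2d_forall.
    intros u v Huv.
    assert (Hx := smooth_on_d_x D f Hf). assert (Hy := smooth_on_d_y D f Hf).
    repeat split.
    + eexists; now apply (smooth_on_is_derive_x D).
    + eexists; now apply (smooth_on_is_derive_y D).
    + eexists; now apply (smooth_on_is_derive_x D (d_y f)).
    + eexists; now apply (smooth_on_is_derive_y D (d_x f)).
  - apply (smooth_on_continuity D (d_x (d_y f))); [|assumption].
    now apply smooth_on_d_x, smooth_on_d_y.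
  - apply (smooth_on_continuity D (d_y (d_x f))); [|assumption].
    now apply smooth_on_d_y, smooth_on_d_x.
Qed.

Lemma d_x_ext_on (D : R * R -> Prop) (f g : R -> R -> R) (x y : R) :
  open D -> (forall u v, D (u, v) -> f u v = g u v) -> D (x, y) -> d_x f x y = d_x g x y.
Proof.
  intros HD H Hxy. apply Derive_ext_loc.
  destruct (open_locally_2d D x y HD Hxy) as [e He].
  exists e. intros z Hz. apply H, He; [exact Hz|].
  rewrite Rminus_diag, Rabs_R0. apply cond_pos.
Qed.

Lemma d_y_ext_on (D : R * R -> Prop) (f g : R -> R -> R) (x y : R) :
  open D -> (forall u v, D (u, v) -> f u v = g u v) -> D (x, y) -> d_y f x y = d_y g x y.
Proof.
  intros HD H Hxy. apply Derive_ext_loc.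
  destruct (open_locally_2d D x y HD Hxy) as [e He].
  exists e. intros z Hz. apply H, He; [|exact Hz].
  rewrite Rminus_diag, Rabs_R0. apply cond_pos.
Qed.

Lemma derive_zero_const (f : R -> R) (a b : R) :
  (forall t, Rmin a b <= t <= Rmax a b -> is_derive f t 0) -> f a = f b.
Proof.
  intros Hd.
  destruct (MVT_gen f a b (fun _ => 0)) as (c & _ & Hc).
  - intros t Ht. apply Hd. lra.
  - intros t Ht. apply derivable_continuous_pt. exists 0.
    apply is_derive_Reals. now apply Hd.
  - lra.
Qed.

Lemma between_in_box (x x' x0 e t : R) :
  Rabs (x - x0) < e -> Rabs (x' - x0) < e -> Rmin x x' <= t <= Rmax x x' ->
  Rabs (t - x0) < e.
Proof.
  unfold Rmin, Rmax. intros H H'. apply Rabs_def2 in H. apply Rabs_def2 in H'.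
  destruct (Rle_dec x x'); intros Ht; apply Rabs_def1; lra.
Qed.

Lemma box_const (f : R -> R -> R) (x0 y0 e : R) :
  (forall x y, Rabs (x - x0) < e -> Rabs (y - y0) < e ->
     is_derive (fun z => f z y) x 0 /\ is_derive (fun z => f x z) y 0) ->
  forall x y, Rabs (x - x0) < e -> Rabs (y - y0) < e -> f x y = f x0 y0.
Proof.
  intros Hd x y Hx Hy.
  assert (H0 : forall r, Rabs (r - r) < e)
    by (intros r; rewrite Rminus_diag, Rabs_R0; apply Rle_lt_trans with (2 := Hx), Rabs_pos).
  transitivity (f x y0).
  - apply (derive_zero_const (fun z => f x z)). intros t Ht.
    refine (proj2 (Hd x t Hx _)). now apply between_in_box with y y0.
  - apply (derive_zero_const (fun z => f z y0)). intros t Ht.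
    refine (proj1 (Hd t y0 _ (H0 y0))). now apply between_in_box with x x0.
Qed.

Lemma connected_const (N : R * R -> Prop) (f : R -> R -> R) :
  open N -> connected N ->
  (forall x y, N (x, y) ->
     is_derive (fun z => f z y) x 0 /\ is_derive (fun z => f x z) y 0) ->
  forall x0 y0 x y, N (x0, y0) -> N (x, y) -> f x y = f x0 y0.
Proof.
  intros HN Hc Hd x0 y0 x y H0 Hxy.
  (* A level set and its complement are both open, as f is locally constant. *)
  assert (Hopen : forall Q : R -> Prop,
    open (fun p : R * R => N p /\ Q (f (fst p) (snd p)))).
  { intros Q [u v] [Huv HQ]. simpl in HQ.
    destruct (open_locally_2d N u v HN Huv) as [e He].
    exists e. intros [a b] [Ha Hb]. split; [now apply He|]. simpl.
    rewrite (box_const f u v e); auto. }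
  destruct (Hc _ _ (Hopen (fun r => r = f x0 y0)) (Hopen (fun r => r <> f x0 y0))) as [H|H].
  - intros p Hp. destruct (Req_dec (f (fst p) (snd p)) (f x0 y0)); tauto.
  - intros p Hp [[_ H1] [_ H2]]. contradiction.
  - exact (proj2 (H (x, y) Hxy)).
  - exfalso. exact (proj2 (H (x0, y0) H0) eq_refl).
Qed.

(** * Closed forms on simply connected sets *)

Definition in_box (c : R * R) (e : R) (p : R * R) : Prop :=
  Rabs (fst p - fst c) < e /\ Rabs (snd p - snd c) < e.

(** The form P dx + Q dy is integrated along a path with sides parallel to the axes, for
    which both partial derivatives in q reduce to one-variable calculus. *)
Definition corner_integral (P Q : R -> R -> R) (p q : R * R) : R :=
  RInt (fun t => P t (snd p)) (fst p) (fst q) + RInt (fun t => Q (fst q) t) (snd p) (snd q).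

Lemma corner_integral_point (P Q : R -> R -> R) (p : R * R) : corner_integral P Q p p = 0.
Proof.
  unfold corner_integral. rewrite !RInt_point. unfold zero; simpl. lra.
Qed.

Lemma is_derive_continuous (f : R -> R) (x l : R) : is_derive f x l -> continuous f x.
Proof.
  intros H. apply (ex_derive_continuous (K := R_AbsRing) (V := R_NormedModule)).
  now exists l.
Qed.

Lemma continuous_slice_x (D : R * R -> Prop) (f : R -> R -> R) (x y : R) :
  smooth_on D f -> D (x, y) -> continuous (fun t => f t y) x.
Proof.
  intros Hf Hxy. eapply is_derive_continuous. now apply (smooth_on_is_derive_x D).
Qed.

Lemma continuous_slice_y (D : R * R -> Prop) (f : R -> R -> R) (x y : R) :
  smooth_on D f -> D (x, y) -> continuous (fun t => f x t) y.
Proof.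
  intros Hf Hxy. eapply is_derive_continuous. now apply (smooth_on_is_derive_y D).
Qed.

Lemma locally_in_interval (x x0 e : R) :
  Rabs (x - x0) < e -> locally x (fun z => Rabs (z - x0) < e).
Proof.
  intros H.
  assert (He : 0 < e - Rabs (x - x0)) by lra.
  exists (mkposreal _ He). intros z Hz.
  change (Rabs (z - x) < e - Rabs (x - x0)) in Hz.
  replace (z - x0) with ((z - x) + (x - x0)) by ring.
  apply Rle_lt_trans with (1 := Rabs_triang _ _). lra.
Qed.

(** On a box the form is closed, so that the corner integrals from a fixed point form a
    primitive of it: in the vertical direction this is the fundamental theorem of
    calculus, in the horizontal one it follows by differentiating under the integral
    sign and using the equality of the cross derivatives. *)
Lemma corner_integral_derive (U : R * R -> Prop) (P Q : R -> R -> R) (c : R * R) (e : R)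
    (p : R * R) (x y : R) :
  smooth_on U P -> smooth_on U Q ->
  (forall x y, U (x, y) -> d_x Q x y = d_y P x y) ->
  (forall q, in_box c e q -> U q) -> in_box c e p -> in_box c e (x, y) ->
  is_derive (fun z => corner_integral P Q p (z, y)) x (P x y) /\
  is_derive (fun z => corner_integral P Q p (x, z)) y (Q x y).
Proof.
  destruct c as [c1 c2], p as [p1 p2]. unfold in_box, corner_integral; simpl.
  intros HP HQ Hcl HU [Hp1 Hp2] [Hx Hy].
  assert (HU' : forall u v, Rabs (u - c1) < e -> Rabs (v - c2) < e -> U (u, v))
    by (intros u v Hu Hv; apply HU; now split).
  split.
  - assert (E : P x y = P x p2 + RInt (fun t => d_x Q x t) p2 y).
    { rewrite (RInt_ext _ (fun t => d_y P x t)).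
      2: { intros t Ht. apply Hcl, HU'; [assumption|].
           apply between_in_box with p2 y; [assumption..|lra]. }
      rewrite (is_RInt_unique (fun t => d_y P x t) p2 y (minus (P x y) (P x p2))).
      { unfold minus, plus, opp; simpl. ring. }
      apply (is_RInt_derive (fun t => P x t)).
      - intros t Ht. apply (smooth_on_is_derive_y U); [assumption|].
        apply HU'; [assumption|]. now apply between_in_box with p2 y.
      - intros t Ht. apply (continuous_slice_y U); [now apply smooth_on_d_y|].
        apply HU'; [assumption|]. now apply between_in_box with p2 y. }
    rewrite E.
    apply (is_derive_plus (K := R_AbsRing) (V := R_NormedModule)).
    + apply (is_derive_RInt (fun t => P t p2) _ p1).
      * generalize (locally_in_interval x c1 e Hx). apply filter_imp.
        intros z Hz. apply (RInt_correct (V := R_CompleteNormedModule)).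
        apply (ex_RInt_continuous (V := R_CompleteNormedModule)). intros t Ht.
        apply (continuous_slice_x U); [assumption|].
        apply HU'; [|assumption]. now apply between_in_box with p1 z.
      * apply (continuous_slice_x U); auto.
    + apply (is_derive_RInt_param Q p2 y x).
      * generalize (locally_in_interval x c1 e Hx). apply filter_imp.
        intros z Hz t Ht. eexists. apply (smooth_on_is_derive_x U); [assumption|].
        apply HU'; [assumption|]. now apply between_in_box with p2 y.
      * intros t Ht. apply (smooth_on_continuity U (d_x Q)); [now apply smooth_on_d_x|].
        apply HU'; [assumption|]. now apply between_in_box with p2 y.
      * generalize (locally_in_interval x c1 e Hx). apply filter_imp.
        intros z Hz. apply (ex_RInt_continuous (V := R_CompleteNormedModule)). intros t Ht.
        apply (continuous_slice_y U); [assumption|].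
        apply HU'; [assumption|]. now apply between_in_box with p2 y.
  - replace (Q x y) with (0 + Q x y) by ring.
    apply (is_derive_plus (K := R_AbsRing) (V := R_NormedModule)).
    + apply (is_derive_const (K := R_AbsRing) (V := R_NormedModule)).
    + apply (is_derive_RInt (fun t => Q x t) _ p2).
      * generalize (locally_in_interval y c2 e Hy). apply filter_imp.
        intros z Hz. apply (RInt_correct (V := R_CompleteNormedModule)).
        apply (ex_RInt_continuous (V := R_CompleteNormedModule)). intros t Ht.
        apply (continuous_slice_y U); [assumption|].
        apply HU'; [assumption|]. now apply between_in_box with p2 z.
      * apply (continuous_slice_y U); auto.
Qed.

(** Both sides have the same partial derivatives with respect to the end point r, and agree
    for r = q. *)
Lemma corner_integral_chasles (U : R * R -> Prop) (P Q : R -> R -> R) (c : R * R) (e : R)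
    (p q r : R * R) :
  smooth_on U P -> smooth_on U Q ->
  (forall x y, U (x, y) -> d_x Q x y = d_y P x y) ->
  (forall z, in_box c e z -> U z) -> in_box c e p -> in_box c e q -> in_box c e r ->
  corner_integral P Q p q + corner_integral P Q q r = corner_integral P Q p r.
Proof.
  intros HP HQ Hcl HU Hp Hq Hr.
  set (f := fun x y => corner_integral P Q p (x, y) - corner_integral P Q q (x, y)).
  assert (Hf : forall x y, in_box c e (x, y) -> f x y = f (fst c) (snd c)).
  { intros x y [Hx Hy]. apply (box_const f (fst c) (snd c) e); [|exact Hx|exact Hy].
    clear x y Hx Hy. intros x y Hx Hy.
    assert (Hxy : in_box c e (x, y)) by now split.
    destruct (corner_integral_derive U P Q c e p x y) as [A1 A2]; auto.
    destruct (corner_integral_derive U P Q c e q x y) as [B1 B2]; auto.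
    split.
    - replace 0 with (minus (P x y) (P x y)) by apply Rminus_diag.
      apply (is_derive_minus (K := R_AbsRing) (V := R_NormedModule)); assumption.
    - replace 0 with (minus (Q x y) (Q x y)) by apply Rminus_diag.
      apply (is_derive_minus (K := R_AbsRing) (V := R_NormedModule)); assumption. }
  destruct q as [q1 q2], r as [r1 r2].
  assert (E := Hf q1 q2 Hq). rewrite <- (Hf r1 r2 Hr) in E. unfold f in E.
  rewrite corner_integral_point in E. lra.
Qed.

(** Continuous partial derivatives make the function differentiable, hence continuous; its
    higher derivatives are those of the two partial derivatives. *)
Lemma smooth_on_of_partials (D : R * R -> Prop) (f P Q : R -> R -> R) :
  open D -> smooth_on D P -> smooth_on D Q ->
  (forall x y, D (x, y) ->
     is_derive (fun z => f z y) x (P x y) /\ is_derive (fun z => f x z) y (Q x y)) ->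
  smooth_on D f.
Proof.
  intros HD HP HQ Hf n x y Hxy.
  assert (Hc : continuity_2d_pt f x y).
  { apply differentiable_continuity_pt. exists (P x y), (Q x y).
    apply filterdiff_differentiable_pt_lim.
    apply (is_derive_filterdiff f x y P (Q x y)).
    - generalize (open_locally_2d D x y HD Hxy). intros H.
      apply locally_2d_locally in H. revert H. apply filter_imp.
      intros [u v] Huv. exact (proj1 (Hf u v Huv)).
    - exact (proj2 (Hf x y Hxy)).
    - apply continuity_2d_pt_filterlim. now apply (smooth_on_continuity D). }
  destruct (Hf x y Hxy) as [H1 H2].
  destruct n as [|n]; [now split|].
  split; [exact Hc|]. split; [eexists; exact H1|]. split; [eexists; exact H2|]. split.
  - apply ex_diff_n_ext_loc with P; [|now apply HP].
    generalize (open_locally_2d D x y HD Hxy). apply locally_2d_impl, locally_2d_forall.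
    intros u v Huv. symmetry. apply is_derive_unique. exact (proj1 (Hf u v Huv)).
  - apply ex_diff_n_ext_loc with Q; [|now apply HQ].
    generalize (open_locally_2d D x y HD Hxy). apply locally_2d_impl, locally_2d_forall.
    intros u v Huv. symmetry. apply is_derive_unique. exact (proj2 (Hf u v Huv)).
Qed.

Fixpoint chain_sum (w : R * R -> R * R -> R) (g : nat -> R * R) (n : nat) : R :=
  match n with
  | O => 0
  | S k => chain_sum w g k + w (g k) (g (S k))
  end.

Lemma chain_sum_ext (w : R * R -> R * R -> R) (g h : nat -> R * R) (n : nat) :
  (forall i, (i <= n)%nat -> g i = h i) -> chain_sum w g n = chain_sum w h n.
Proof.
  induction n as [|n IH]; intros H; simpl; [reflexivity|].
  rewrite IH by (intros i Hi; apply H; lia). now rewrite !H by lia.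
Qed.

Lemma chain_sum_const (w : R * R -> R * R -> R) (p : R * R) (n : nat) :
  w p p = 0 -> chain_sum w (fun _ => p) n = 0.
Proof. intros H. induction n as [|n IH]; simpl; [reflexivity|]. now rewrite IH, H, Rplus_0_l. Qed.

Lemma chain_sum_cat (w : R * R -> R * R -> R) (g : nat -> R * R) (m n : nat) :
  chain_sum w g (m + n) = chain_sum w g m + chain_sum w (fun i => g (m + i)%nat) n.
Proof.
  induction n as [|n IH]; simpl.
  - rewrite Nat.add_0_r. ring.
  - rewrite <- plus_n_Sm. simpl. rewrite IH. ring.
Qed.

Lemma chain_sum_head (w : R * R -> R * R -> R) (g : nat -> R * R) (n : nat) :
  chain_sum w g (S n) = w (g O) (g 1%nat) + chain_sum w (fun i => g (S i)) n.
Proof.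
  change (chain_sum w g (1 + n) = w (g O) (g 1%nat) + chain_sum w (fun i => g (S i)) n).
  rewrite chain_sum_cat. simpl. ring.
Qed.

Lemma chain_sum_rev (w : R * R -> R * R -> R) (g : nat -> R * R) (n : nat) :
  (forall i, (i < n)%nat -> w (g (S i)) (g i) = - w (g i) (g (S i))) ->
  chain_sum w (fun i => g (n - i)%nat) n = - chain_sum w g n.
Proof.
  induction n as [|n IH]; intros H; [simpl; ring|].
  rewrite chain_sum_head.
  rewrite (chain_sum_ext w _ (fun i => g (n - i)%nat)) by (intros i Hi; reflexivity).
  rewrite IH by (intros i Hi; apply H; lia).
  simpl. rewrite Nat.sub_0_r, H by lia. ring.
Qed.

Lemma chain_sum_double (w : R * R -> R * R -> R) (g : nat -> R * R) (n : nat) :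
  (forall i, (i < n)%nat ->
     w (g (2 * i)%nat) (g (2 * i + 1)%nat) + w (g (2 * i + 1)%nat) (g (2 * (i + 1))%nat)
     = w (g (2 * i)%nat) (g (2 * (i + 1))%nat)) ->
  chain_sum w g (2 * n) = chain_sum w (fun i => g (2 * i)%nat) n.
Proof.
  induction n as [|n IH]; intros H; [reflexivity|].
  replace (2 * S n)%nat with (S (S (2 * n))) by lia.
  cbn [chain_sum]. rewrite IH by (intros i Hi; apply H; lia).
  assert (E := H n (Nat.lt_succ_diag_r n)).
  replace (2 * n + 1)%nat with (S (2 * n)) in E by lia.
  replace (2 * (n + 1))%nat with (S (S (2 * n))) in E by lia.
  replace (2 * S n)%nat with (S (S (2 * n))) by lia. lra.
Qed.

Lemma chain_sum_telescope (w : R * R -> R * R -> R) (A : R * R -> Prop)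
    (g : nat -> R * R) (n : nat) :
  (forall p q r, A p -> A q -> A r -> w p q + w q r = w p r) ->
  (forall i, (i <= n)%nat -> A (g i)) -> chain_sum w g n = w (g O) (g n).
Proof.
  intros Hw. induction n as [|n IH]; intros Hg; simpl.
  - assert (H := Hg O (le_n O)). assert (E := Hw _ _ _ H H H). lra.
  - rewrite IH by (intros i Hi; apply Hg; lia). apply Hw; apply Hg; lia.
Qed.

(** Adding up the cell equations, the inner edges cancel. *)
Lemma chain_sum_grid (w : R * R -> R * R -> R) (g : nat -> nat -> R * R) (n m : nat) :
  (forall i j, (i < n)%nat -> (j < m)%nat ->
     w (g i j) (g (S i) j) + w (g (S i) j) (g (S i) (S j))
     = w (g i j) (g i (S j)) + w (g i (S j)) (g (S i) (S j))) ->
  chain_sum w (fun i => g i O) n + chain_sum w (g n) m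
  = chain_sum w (g O) m + chain_sum w (fun i => g i m) n.
Proof.
  intros Hcell.
  assert (Hstrip : forall j k, (j < m)%nat -> (k <= n)%nat ->
    chain_sum w (fun i => g i j) k + w (g k j) (g k (S j))
    = w (g O j) (g O (S j)) + chain_sum w (fun i => g i (S j)) k).
  { intros j k Hj. induction k as [|k IH]; intros Hk; simpl; [ring|].
    assert (E1 := IH ltac:(lia)). assert (E2 := Hcell k j ltac:(lia) Hj). lra. }
  clear Hcell. induction m as [|m IH]; simpl; [ring|].
  assert (E1 := IH ltac:(intros; apply Hstrip; lia)).
  assert (E2 := Hstrip m n ltac:(lia) ltac:(lia)). lra.
Qed.

Lemma continuous_into_box (h : R * R -> R * R) (z : R * R) (e : R) :
  0 < e -> continuous h z ->
  locally z (fun z' => in_box (h z) e (h z')).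
Proof.
  intros He Hh. apply (Hh (in_box (h z) e)).
  exists (mkposreal e He). intros q [H1 H2]. now split.
Qed.

(** By compactness of the square one radius serves all its points: the image of every square
    of that radius centred in it lies in a box inside U. *)
Lemma lebesgue_number (U : R * R -> Prop) (h : R * R -> R * R) :
  open U -> (forall z, continuous h z) ->
  (forall t s, 0 <= t <= 1 -> 0 <= s <= 1 -> U (h (t, s))) ->
  exists d : posreal, forall t s, 0 <= t <= 1 -> 0 <= s <= 1 ->
    exists c e, (forall q, in_box c e q -> U q) /\
      forall t' s', Rabs (t' - t) < d -> Rabs (s' - s) < d -> in_box c e (h (t', s')).
Proof.
  intros HU Hh HhU.
  assert (Hloc : forall z : R * R, exists d : posreal,
    0 <= fst z <= 1 -> 0 <= snd z <= 1 ->
    exists c e, (forall q, in_box c e q -> U q) /\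
      forall t' s', Rabs (t' - fst z) < 2 * d -> Rabs (s' - snd z) < 2 * d ->
        in_box c e (h (t', s'))).
  { intros [t s]; simpl.
    destruct (classic (0 <= t <= 1 /\ 0 <= s <= 1)) as [[Ht Hs]|Hn].
    - destruct (HU (h (t, s)) (HhU t s Ht Hs)) as [e He].
      destruct (continuous_into_box h (t, s) e (cond_pos e) (Hh (t, s))) as [d Hd].
      assert (Hd2 : 0 < d / 2) by (assert (Hdp := cond_pos d); lra).
      exists (mkposreal _ Hd2). intros _ _. exists (h (t, s)), e. split.
      + intros q [H1 H2]. apply He. now split.
      + simpl. intros t' s' H1 H2. apply Hd.
        replace (2 * (d / 2)) with (pos d) in * by field. now split.
    - exists (mkposreal 1 Rlt_0_1). intros Ht Hs. tauto. }
  set (delta := fun z => proj1_sig (constructive_indefinite_description _ (Hloc z))).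
  assert (Hdelta := fun z => proj2_sig (constructive_indefinite_description _ (Hloc z))).
  fold delta in Hdelta. simpl in Hdelta.
  destruct (compactness_value_2d 0 1 0 1 (fun t s => delta (t, s))) as [d Hd].
  exists d. intros t s Ht Hs.
  destruct (NNPP _ (Hd t s Ht Hs)) as (u & v & Hu & Hv & Htu & Hsv & Hle).
  destruct (Hdelta (u, v) Hu Hv) as (c & e & HcU & Hbox).
  change (proj1_sig _) with (delta (u, v)) in Hbox.
  exists c, e. split; [exact HcU|].
  intros t' s' Ht' Hs'. apply Hbox; simpl.
  - replace (t' - u) with ((t' - t) + (t - u)) by ring.
    apply Rle_lt_trans with (1 := Rabs_triang _ _). lra.
  - replace (s' - v) with ((s' - s) + (s - v)) by ring.
    apply Rle_lt_trans with (1 := Rabs_triang _ _). lra.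
Qed.

Definition grid_point (n i : nat) : R := INR i / INR n.

Lemma grid_point_in_unit (n i : nat) :
  (0 < n)%nat -> (i <= n)%nat -> 0 <= grid_point n i <= 1.
Proof.
  intros Hn Hi. unfold grid_point.
  assert (Hn' : 0 < INR n) by now apply lt_0_INR.
  apply le_INR in Hi. assert (H0 := pos_INR i).
  split.
  - apply Rmult_le_pos; [exact H0|]. apply Rlt_le. now apply Rinv_0_lt_compat.
  - apply Rmult_le_reg_r with (INR n); [exact Hn'|].
    unfold Rdiv. rewrite Rmult_assoc, Rinv_l by lra. lra.
Qed.

Lemma grid_point_full (n : nat) : (0 < n)%nat -> grid_point n n = 1.
Proof.
  intros Hn. unfold grid_point. apply Rinv_r. apply not_0_INR. lia.
Qed.

Lemma grid_point_zero (n : nat) : grid_point n 0 = 0.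
Proof. unfold grid_point. simpl. unfold Rdiv. ring. Qed.

Lemma grid_point_scale (n k i : nat) :
  (0 < n)%nat -> (0 < k)%nat -> grid_point (k * n) (k * i) = grid_point n i.
Proof.
  intros Hn Hk. unfold grid_point. rewrite !mult_INR. field.
  split; apply not_0_INR; lia.
Qed.

Lemma grid_point_step (d : posreal) :
  exists n0, (0 < n0)%nat /\
    forall n i, (n0 <= n)%nat -> Rabs (grid_point n (S i) - grid_point n i) < d.
Proof.
  destruct (archimed_cor1 d (cond_pos d)) as (n0 & Hn0 & Hpos).
  exists n0. split; [exact Hpos|]. intros n i Hn. unfold grid_point.
  assert (H0 : 0 < INR n0) by (apply lt_0_INR; lia).
  assert (Hn' : INR n0 <= INR n) by now apply le_INR.
  rewrite S_INR.
  replace ((INR i + 1) / INR n - INR i / INR n) with (/ INR n) by (field; lra).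
  rewrite Rabs_right.
  - apply Rle_lt_trans with (2 := Hn0). now apply Rinv_le_contravar.
  - apply Rle_ge, Rlt_le, Rinv_0_lt_compat. lra.
Qed.

(** The property of corner integrals of a closed form on which integration along paths
    rests. *)
Definition additive_on_boxes (U : R * R -> Prop) (w : R * R -> R * R -> R) : Prop :=
  forall c e p q r, (forall z, in_box c e z -> U z) ->
    in_box c e p -> in_box c e q -> in_box c e r -> w p q + w q r = w p r.

Definition path_sum (w : R * R -> R * R -> R) (c : R -> R * R) (n : nat) : R :=
  chain_sum w (fun i => c (grid_point n i)) n.

Lemma in_box_center (c : R * R) (e : R) : 0 < e -> in_box c e c.
Proof. intros He. split; now rewrite Rminus_diag, Rabs_R0. Qed.

Lemma additive_point (U : R * R -> Prop) (w : R * R -> R * R -> R) (p : R * R) :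
  open U -> additive_on_boxes U w -> U p -> w p p = 0.
Proof.
  intros HU Hw Hp. destruct (HU p Hp) as [e He].
  assert (Hc := in_box_center p e (cond_pos e)).
  assert (E : w p p + w p p = w p p).
  { apply (Hw p e); [|exact Hc..]. intros z [H1 H2]. apply He. now split. }
  lra.
Qed.

(** The image of a sufficiently fine grid under a homotopy to a constant path has cells
    lying in boxes inside U; the boundary sum of each cell vanishes, hence so does that
    of the whole square, three sides of which are constant. *)
Lemma loop_sum_zero (U : R * R -> Prop) (w : R * R -> R * R -> R) (c : R -> R * R) :
  open U -> simply_connected U -> additive_on_boxes U w -> path_in U c -> c 0 = c 1 ->
  exists n0, forall n, (n0 <= n)%nat -> path_sum w c n = 0.
Proof.
  intros HU [_ Hsc] Hw Hc Hloop.
  destruct (Hsc c Hc Hloop) as (h & Hh & HhU & Hts & Hss).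
  destruct (lebesgue_number U h HU Hh HhU) as [d Hd].
  destruct (grid_point_step d) as (n0 & Hn0 & Hstep).
  exists n0. intros n Hn.
  assert (Hpos : (0 < n)%nat) by lia.
  set (s := grid_point n).
  assert (Hs : forall i, (i <= n)%nat -> 0 <= s i <= 1)
    by (intros i Hi; now apply grid_point_in_unit).
  assert (Hp : w (c 0) (c 0) = 0).
  { apply (additive_point U); auto. apply (proj2 Hc). lra. }
  assert (E := chain_sum_grid w (fun i j => h (s i, s j)) n n).
  rewrite (chain_sum_ext w (fun i => h (s i, s O)) (fun i => c (s i))) in E.
  2: { intros i Hi. unfold s at 2. rewrite grid_point_zero. now apply Hts, Hs. }
  rewrite (chain_sum_ext w (fun i => h (s i, s n)) (fun _ => c 0)) in E.
  2: { intros i Hi. unfold s at 2. rewrite grid_point_full by exact Hpos.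
       now apply Hts, Hs. }
  rewrite (chain_sum_ext w (fun j => h (s n, s j)) (fun _ => c 0)) in E.
  2: { intros i Hi. unfold s at 1. rewrite grid_point_full by exact Hpos.
       now apply Hss, Hs. }
  rewrite (chain_sum_ext w (fun j => h (s O, s j)) (fun _ => c 0)) in E.
  2: { intros i Hi. unfold s at 1. rewrite grid_point_zero. now apply Hss, Hs. }
  rewrite !chain_sum_const in E by exact Hp.
  unfold path_sum. fold s. rewrite <- (Rplus_0_r (chain_sum _ _ n)), E; [ring|].
  intros i j Hi Hj.
  destruct (Hd (s i) (s j)) as (b & e & HbU & Hbox); [apply Hs; lia..|].
  assert (Hi1 : Rabs (s (S i) - s i) < d) by now apply Hstep.
  assert (Hj1 : Rabs (s (S j) - s j) < d) by now apply Hstep.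
  assert (H0 : forall r, Rabs (r - r) < d)
    by (intros r; rewrite Rminus_diag, Rabs_R0; apply cond_pos).
  rewrite (Hw b e) by auto. rewrite (Hw b e) by auto. reflexivity.
Qed.

Lemma path_steps_in_boxes (U : R * R -> Prop) (c : R -> R * R) :
  open U -> path_in U c ->
  exists n0, (0 < n0)%nat /\ forall n i, (n0 <= n)%nat -> (i < n)%nat ->
    exists b e, (forall z, in_box b e z -> U z) /\
      forall t, grid_point n i <= t <= grid_point n (S i) -> in_box b e (c t).
Proof.
  intros HU [Hc HcU].
  destruct (lebesgue_number U (fun z => c (fst z))) as [d Hd].
  - exact HU.
  - intros z. apply (continuous_comp fst c); [apply continuous_fst|apply Hc].
  - intros t s Ht _. now apply HcU.
  - destruct (grid_point_step d) as (n0 & Hn0 & Hstep).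
    exists n0. split; [exact Hn0|]. intros n i Hn Hi.
    destruct (Hd (grid_point n i) 0) as (b & e & HbU & Hbox).
    { apply grid_point_in_unit; lia. }
    { lra. }
    exists b, e. split; [exact HbU|]. intros t Ht.
    apply (Hbox t 0).
    + assert (H := Hstep n i Hn). apply Rabs_def2 in H. apply Rabs_def1; lra.
    + rewrite Rminus_diag, Rabs_R0. apply cond_pos.
Qed.

Lemma grid_point_le (n i j : nat) :
  (0 < n)%nat -> (i <= j)%nat -> grid_point n i <= grid_point n j.
Proof.
  intros Hn Hij. apply Rmult_le_compat_r; [|now apply le_INR].
  apply Rlt_le, Rinv_0_lt_compat. now apply lt_0_INR.
Qed.

(** Halving the steps of a fine subdivision does not change the path sum, by additivity in
    the box that contains a step. *)
Lemma path_sum_double (U : R * R -> Prop) (w : R * R -> R * R -> R) (c : R -> R * R) :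
  open U -> additive_on_boxes U w -> path_in U c ->
  exists n0, forall n, (n0 <= n)%nat -> path_sum w c (2 * n) = path_sum w c n.
Proof.
  intros HU Hw Hc.
  destruct (path_steps_in_boxes U c HU Hc) as (n0 & Hn0 & Hbox).
  exists n0. intros n Hn. unfold path_sum.
  rewrite chain_sum_double.
  - apply chain_sum_ext. intros i Hi. now rewrite grid_point_scale by lia.
  - intros i Hi. destruct (Hbox n i Hn Hi) as (b & e & HbU & Hb).
    rewrite <- (grid_point_scale n 2 i), <- (grid_point_scale n 2 (S i)) in Hb by lia.
    replace (i + 1)%nat with (S i) by lia.
    apply (Hw b e); [exact HbU|apply Hb..]; split; apply grid_point_le; lia.
Qed.

(** The path sums over the dyadic subdivisions are eventually constant, so that this
    limit is their common value from some point on. *)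
Definition path_integral (w : R * R -> R * R -> R) (c : R -> R * R) : R :=
  real (Lim_seq (fun k => path_sum w c (2 ^ k))).

Lemma path_integral_eventually (U : R * R -> Prop) (w : R * R -> R * R -> R)
    (c : R -> R * R) :
  open U -> additive_on_boxes U w -> path_in U c ->
  exists k0, forall k, (k0 <= k)%nat -> path_sum w c (2 ^ k) = path_integral w c.
Proof.
  intros HU Hw Hc. destruct (path_sum_double U w c HU Hw Hc) as [n0 Hn0].
  assert (Hconst : forall k, path_sum w c (2 ^ (n0 + k)) = path_sum w c (2 ^ n0)).
  { induction k as [|k IH]; [now rewrite Nat.add_0_r|].
    rewrite <- plus_n_Sm, Nat.pow_succ_r', Hn0; [exact IH|].
    apply Nat.le_trans with (n0 + k)%nat; [lia|].
    apply Nat.lt_le_incl, Nat.pow_gt_lin_r. lia. }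
  exists n0. intros k Hk.
  replace k with (n0 + (k - n0))%nat by lia. rewrite Hconst.
  unfold path_integral.
  rewrite (is_lim_seq_unique _ (Finite (path_sum w c (2 ^ n0)))); [reflexivity|].
  apply (is_lim_seq_ext_loc (fun _ => path_sum w c (2 ^ n0))).
  - exists n0. intros m Hm. rewrite <- (Hconst (m - n0)%nat).
    f_equal. f_equal. lia.
  - apply is_lim_seq_const.
Qed.

Definition clamp (a b t : R) : R := Rmax a (Rmin b t).

Lemma clamp_in (a b t : R) : a <= b -> a <= clamp a b t <= b.
Proof.
  intros H. unfold clamp, Rmax, Rmin.
  destruct (Rle_dec b t); destruct (Rle_dec a _); lra.
Qed.

Lemma clamp_id (a b t : R) : a <= t <= b -> clamp a b t = t.
Proof.
  intros H. unfold clamp, Rmax, Rmin.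
  destruct (Rle_dec b t); destruct (Rle_dec a _); lra.
Qed.

Lemma clamp_below (a b t : R) : a <= b -> t <= a -> clamp a b t = a.
Proof.
  intros H. unfold clamp, Rmax, Rmin.
  destruct (Rle_dec b t); destruct (Rle_dec a _); lra.
Qed.

Lemma clamp_above (a b t : R) : a <= b -> b <= t -> clamp a b t = b.
Proof.
  intros H. unfold clamp, Rmax, Rmin.
  destruct (Rle_dec b t); destruct (Rle_dec a _); lra.
Qed.

Lemma clamp_lipschitz (a b s t : R) : Rabs (clamp a b s - clamp a b t) <= Rabs (s - t).
Proof.
  unfold clamp, Rmin. destruct (Rle_dec b s), (Rle_dec b t); unfold Rmax;
    repeat match goal with |- context [Rle_dec ?x ?y] => destruct (Rle_dec x y) end;
    unfold Rabs; repeat match goal with |- context [Rcase_abs ?x] => destruct (Rcase_abs x) end;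
    lra.
Qed.

Lemma lipschitz_continuous (f : R -> R) (L t : R) :
  (forall s, Rabs (f s - f t) <= L * Rabs (s - t)) -> continuous f t.
Proof.
  intros Hf. apply filterlim_locally. intros e.
  assert (HL : 0 < Rabs L + 1) by (assert (H := Rabs_pos L); lra).
  assert (Hd : 0 < e / (Rabs L + 1)) by (apply Rdiv_lt_0_compat; [apply cond_pos|exact HL]).
  exists (mkposreal _ Hd). intros s Hs. change (Rabs (s - t) < e / (Rabs L + 1)) in Hs.
  change (Rabs (f s - f t) < e).
  apply Rle_lt_trans with (1 := Hf s).
  apply Rle_lt_trans with ((Rabs L + 1) * Rabs (s - t)).
  - apply Rmult_le_compat_r; [apply Rabs_pos|]. assert (H := Rle_abs L). lra.
  - apply Rmult_lt_reg_r with (/ (Rabs L + 1)); [now apply Rinv_0_lt_compat|].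
    replace ((Rabs L + 1) * Rabs (s - t) * / (Rabs L + 1)) with (Rabs (s - t))
      by (field; lra).
    exact Hs.
Qed.

Lemma continuous_clamp (a b t : R) : continuous (clamp a b) t.
Proof.
  apply (lipschitz_continuous _ 1). intros s. rewrite Rmult_1_l. apply clamp_lipschitz.
Qed.

Lemma continuous_pair (f g : R -> R) (t : R) :
  continuous f t -> continuous g t -> continuous (fun s => (f s, g s)) t.
Proof.
  intros Hf Hg. apply filterlim_locally. intros e.
  generalize (proj1 (filterlim_locally _ _) Hf e) (proj1 (filterlim_locally _ _) Hg e).
  intros H1 H2. generalize (filter_and _ _ H1 H2). apply filter_imp.
  intros s [A B]. now split.
Qed.

Lemma continuous_affine (a b t : R) : continuous (fun s => a * s + b) t.
Proof.
  apply (lipschitz_continuous _ (Rabs a)). intros s.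
  replace (a * s + b - (a * t + b)) with (a * (s - t)) by ring.
  rewrite Rabs_mult. lra.
Qed.

(** The path that follows c1, then the segment from its end to the end of c2, then c2
    backwards, each in one third of the unit interval. *)
Definition loop_through (c1 c2 : R -> R * R) (t : R) : R * R :=
  (fst (c1 (clamp 0 1 (3 * t + 0)))
   + clamp 0 1 (3 * t + -1) * (fst (c2 1) - fst (c1 1))
   + (fst (c2 (clamp 0 1 (-3 * t + 3))) - fst (c2 1)),
   snd (c1 (clamp 0 1 (3 * t + 0)))
   + clamp 0 1 (3 * t + -1) * (snd (c2 1) - snd (c1 1))
   + (snd (c2 (clamp 0 1 (-3 * t + 3))) - snd (c2 1))).

Definition segment (p q : R * R) (t : R) : R * R :=
  (fst p + t * (fst q - fst p), snd p + t * (snd q - snd p)).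

Lemma loop_through_1 (c1 c2 : R -> R * R) (t : R) :
  0 <= t <= 1 -> loop_through c1 c2 (t / 3) = c1 t.
Proof.
  intros Ht. unfold loop_through.
  rewrite (clamp_id 0 1 (3 * (t / 3) + 0)), (clamp_below 0 1 (3 * (t / 3) + -1)),
    (clamp_above 0 1 (-3 * (t / 3) + 3)) by lra.
  replace (3 * (t / 3) + 0) with t by field.
  rewrite (surjective_pairing (c1 t)) at 3. f_equal; ring.
Qed.

Lemma loop_through_2 (c1 c2 : R -> R * R) (t : R) :
  0 <= t <= 1 -> loop_through c1 c2 ((1 + t) / 3) = segment (c1 1) (c2 1) t.
Proof.
  intros Ht. unfold loop_through, segment.
  rewrite (clamp_above 0 1 (3 * ((1 + t) / 3) + 0)), (clamp_id 0 1 (3 * ((1 + t) / 3) + -1)),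
    (clamp_above 0 1 (-3 * ((1 + t) / 3) + 3)) by lra.
  replace (3 * ((1 + t) / 3) + -1) with t by field.
  f_equal; ring.
Qed.

Lemma loop_through_3 (c1 c2 : R -> R * R) (t : R) :
  0 <= t <= 1 -> loop_through c1 c2 ((2 + t) / 3) = c2 (1 - t).
Proof.
  intros Ht. unfold loop_through.
  rewrite (clamp_above 0 1 (3 * ((2 + t) / 3) + 0)), (clamp_above 0 1 (3 * ((2 + t) / 3) + -1)),
    (clamp_id 0 1 (-3 * ((2 + t) / 3) + 3)) by lra.
  replace (-3 * ((2 + t) / 3) + 3) with (1 - t) by field.
  rewrite (surjective_pairing (c2 (1 - t))) at 3. f_equal; ring.
Qed.

Lemma segment_in_box (b : R * R) (e : R) (p q : R * R) (t : R) :
  in_box b e p -> in_box b e q -> 0 <= t <= 1 -> in_box b e (segment p q t).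
Proof.
  intros [Hp1 Hp2] [Hq1 Hq2] Ht.
  assert (K : forall u v c, Rabs (u - c) < e -> Rabs (v - c) < e ->
    Rabs (u + t * (v - u) - c) < e).
  { intros u v c Hu Hv.
    assert (HM := Rmax_lub_lt _ _ _ Hu Hv).
    assert (Mu := Rmax_l (Rabs (u - c)) (Rabs (v - c))).
    assert (Mv := Rmax_r (Rabs (u - c)) (Rabs (v - c))).
    replace (u + t * (v - u) - c) with ((1 - t) * (u - c) + t * (v - c)) by ring.
    apply Rle_lt_trans with (1 := Rabs_triang _ _).
    rewrite !Rabs_mult, (Rabs_right t), (Rabs_right (1 - t)) by lra.
    apply Rle_lt_trans with (2 := HM).
    set (M := Rmax _ _) in *. nra. }
  split; now apply K.
Qed.

Lemma path_in_loop_through (U : R * R -> Prop) (c1 c2 : R -> R * R) (b : R * R) (e : R) :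
  path_in U c1 -> path_in U c2 -> (forall z, in_box b e z -> U z) ->
  in_box b e (c1 1) -> in_box b e (c2 1) -> path_in U (loop_through c1 c2).
Proof.
  intros [C1 U1] [C2 U2] HbU B1 B2. split.
  - intros t.
    assert (Hcl : forall a b', continuous (fun s => clamp 0 1 (a * s + b')) t).
    { intros a b'. apply (continuous_comp (fun s => a * s + b') (clamp 0 1)).
      apply continuous_affine. apply continuous_clamp. }
    assert (Hf : forall (c : R -> R * R) a b', (forall s, continuous c s) ->
      continuous (fun s => fst (c (clamp 0 1 (a * s + b')))) t).
    { intros c a b' Hc. apply (continuous_comp (fun s => c (clamp 0 1 (a * s + b'))) fst).
      apply (continuous_comp (fun s => clamp 0 1 (a * s + b')) c); auto.
      apply continuous_fst. }
    assert (Hs : forall (c : R -> R * R) a b', (forall s, continuous c s) ->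
      continuous (fun s => snd (c (clamp 0 1 (a * s + b')))) t).
    { intros c a b' Hc. apply (continuous_comp (fun s => c (clamp 0 1 (a * s + b'))) snd).
      apply (continuous_comp (fun s => clamp 0 1 (a * s + b')) c); auto.
      apply continuous_snd. }
    apply continuous_pair.
    + apply (continuous_plus (V := R_NormedModule)); [apply (continuous_plus (V := R_NormedModule))|].
      * now apply Hf.
      * apply (continuous_mult (K := R_AbsRing)); [apply Hcl|apply continuous_const].
      * apply (continuous_minus (V := R_NormedModule)); [now apply Hf|apply continuous_const].
    + apply (continuous_plus (V := R_NormedModule)); [apply (continuous_plus (V := R_NormedModule))|].
      * now apply Hs.
      * apply (continuous_mult (K := R_AbsRing)); [apply Hcl|apply continuous_const].
      * apply (continuous_minus (V := R_NormedModule)); [now apply Hs|apply continuous_const].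
  - intros t Ht.
    destruct (Rle_dec t (1 / 3)) as [H1|H1]; [|destruct (Rle_dec t (2 / 3)) as [H2|H2]].
    + replace t with (3 * t / 3) by field. rewrite loop_through_1 by lra. apply U1. lra.
    + replace t with ((1 + (3 * t - 1)) / 3) by field. rewrite loop_through_2 by lra.
      apply HbU, segment_in_box; auto. lra.
    + replace t with ((2 + (3 * t - 2)) / 3) by field. rewrite loop_through_3 by lra.
      apply U2. lra.
Qed.

Lemma grid_point_third (n j i : nat) :
  (0 < n)%nat -> grid_point (3 * n) (j * n + i) = (INR j + grid_point n i) / 3.
Proof.
  intros Hn. unfold grid_point. rewrite plus_INR, !mult_INR. simpl. field.
  apply not_0_INR. lia.
Qed.

(** The path through c1, a segment and the reverse of c2 is a loop, whose path sums vanish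
    for fine subdivisions; subdividing each third dyadically splits such a sum into the three
    contributions. *)
Lemma path_integral_difference (U : R * R -> Prop) (w : R * R -> R * R -> R)
    (c1 c2 : R -> R * R) (b : R * R) (e : R) :
  open U -> simply_connected U -> additive_on_boxes U w ->
  path_in U c1 -> path_in U c2 -> c1 0 = c2 0 -> (forall z, in_box b e z -> U z) ->
  in_box b e (c1 1) -> in_box b e (c2 1) ->
  path_integral w c2 = path_integral w c1 + w (c1 1) (c2 1).
Proof.
  intros HU Hsc Hw H1 H2 H0 HbU B1 B2.
  assert (HL := path_in_loop_through U c1 c2 b e H1 H2 HbU B1 B2).
  destruct (loop_sum_zero U w _ HU Hsc Hw HL) as [n0 Hn0].
  { rewrite <- (loop_through_1 c1 c2) in H0 by lra.
    replace (c2 0) with (c2 (1 - 1)) in H0 by (f_equal; ring).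
    rewrite <- (loop_through_3 c1 c2) in H0 by lra.
    replace (0 / 3) with 0 in H0 by field. replace ((2 + 1) / 3) with 1 in H0 by field.
    exact H0. }
  destruct (path_integral_eventually U w c1 HU Hw H1) as [k1 K1].
  destruct (path_integral_eventually U w c2 HU Hw H2) as [k2 K2].
  destruct (path_steps_in_boxes U c2 HU H2) as (n2 & _ & Hbox2).
  set (k := (n0 + k1 + k2 + n2)%nat). set (n := (2 ^ k)%nat).
  assert (Hn : (k < n)%nat) by (apply Nat.pow_gt_lin_r; lia).
  rewrite <- (K1 k), <- (K2 k) by lia. fold n.
  assert (E := Hn0 (3 * n)%nat ltac:(lia)). unfold path_sum in E.
  assert (Hsub := fun i => grid_point_in_unit n i ltac:(lia)).
  replace (chain_sum w _ (3 * n)) with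
    (chain_sum w (fun i => loop_through c1 c2 (grid_point (3 * n) i)) (n + n + n)) in E
    by (f_equal; lia).
  rewrite !chain_sum_cat in E.
  rewrite (chain_sum_ext w _ (fun i => c1 (grid_point n i))) in E.
  2: { intros i Hi. rewrite <- (loop_through_1 c1 c2) by now apply Hsub. f_equal.
       assert (E0 := grid_point_third n 0 i ltac:(lia)). rewrite Nat.mul_0_l in E0.
       change (0 + i)%nat with i in E0. rewrite E0. simpl. field. }
  rewrite (chain_sum_ext w (fun i => loop_through _ _ (grid_point _ (n + i)))
    (fun i => segment (c1 1) (c2 1) (grid_point n i))) in E.
  2: { intros i Hi. rewrite <- loop_through_2 by now apply Hsub. f_equal.
       assert (E1 := grid_point_third n 1 i ltac:(lia)). rewrite Nat.mul_1_l in E1.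
       rewrite E1. simpl. field. }
  rewrite (chain_sum_ext w (fun i => loop_through _ _ (grid_point _ (n + n + i)))
    (fun i => c2 (grid_point n (n - i)))) in E.
  2: { intros i Hi.
       replace (grid_point n (n - i)) with (1 - grid_point n i).
       - rewrite <- (loop_through_3 c1 c2) by now apply Hsub. f_equal.
         replace (n + n)%nat with (2 * n)%nat by lia.
         rewrite (grid_point_third n 2 i) by lia. simpl. field.
       - unfold grid_point. rewrite minus_INR by exact Hi. field. apply not_0_INR. lia. }
  rewrite (chain_sum_rev w (fun i => c2 (grid_point n i))) in E.
  2: { intros i Hi. destruct (Hbox2 n i ltac:(lia) Hi) as (b' & e' & HU' & Hb').
       assert (Hle : grid_point n i <= grid_point n (S i)) by (apply grid_point_le; lia).
       assert (P1 := Hb' (grid_point n i) ltac:(lra)).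
       assert (P2 := Hb' (grid_point n (S i)) ltac:(lra)).
       assert (E1 := Hw b' e' _ _ _ HU' P1 P2 P1).
       rewrite (additive_point U w) in E1; auto. lra. }
  rewrite (chain_sum_telescope w (in_box b e)
    (fun i => segment (c1 1) (c2 1) (grid_point n i))) in E.
  - rewrite grid_point_zero, grid_point_full in E by lia.
    replace (segment (c1 1) (c2 1) 0) with (c1 1) in E.
    2: { unfold segment. rewrite (surjective_pairing (c1 1)) at 1. f_equal; ring. }
    replace (segment (c1 1) (c2 1) 1) with (c2 1) in E.
    2: { unfold segment. rewrite (surjective_pairing (c2 1)) at 1. f_equal; ring. }
    unfold path_sum. lra.
  - intros p q r Hp Hq Hr. now apply (Hw b e).
  - intros i Hi. apply segment_in_box; auto.
Qed.

(** On a simply connected open set every closed form is exact: integrals along paths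
    from a base point give a primitive. *)
Lemma poincare (U : R * R -> Prop) (P Q : R -> R -> R) :
  open U -> simply_connected U -> smooth_on U P -> smooth_on U Q ->
  (forall x y, U (x, y) -> d_x Q x y = d_y P x y) ->
  exists psi, smooth_on U psi /\
    forall x y, U (x, y) -> d_x psi x y = P x y /\ d_y psi x y = Q x y.
Proof.
  intros HU Hsc HP HQ Hcl.
  destruct (classic (exists p, U p)) as [[p0 Hp0]|Hempty].
  2: { exists (fun _ _ => 0). split.
       - intros n x y Hxy. exfalso. eauto.
       - intros x y Hxy. exfalso. eauto. }
  set (w := corner_integral P Q).
  assert (Hw : additive_on_boxes U w).
  { intros c e p q r HcU Hp Hq Hr. now apply (corner_integral_chasles U P Q c e). }
  assert (Hpath : forall p, exists c, U p -> path_in U c /\ c 0 = p0 /\ c 1 = p).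
  { intros p. destruct (classic (U p)) as [Hp|Hp].
    - destruct (proj1 Hsc p0 p Hp0 Hp) as [c Hc]. now exists c.
    - exists (fun _ => p). tauto. }
  set (gamma := fun p => proj1_sig (constructive_indefinite_description _ (Hpath p))).
  assert (Hgamma : forall p, U p -> path_in U (gamma p) /\ gamma p 0 = p0 /\ gamma p 1 = p)
    by (intros p; exact (proj2_sig (constructive_indefinite_description _ (Hpath p)))).
  set (psi := fun x y => path_integral w (gamma (x, y))).
  assert (Hloc : forall x y, U (x, y) -> exists e : posreal,
    (forall z, in_box (x, y) e z -> U z) /\
    forall u v, in_box (x, y) e (u, v) -> psi u v = psi x y + w (x, y) (u, v)).
  { intros x y Hxy. destruct (HU (x, y) Hxy) as [e He].
    exists e.
    assert (HeU : forall z, in_box (x, y) e z -> U z).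
    { intros z [Z1 Z2]. apply He. now split. }
    split; [exact HeU|].
    intros u v Huv.
    destruct (Hgamma (x, y) Hxy) as (A1 & A2 & A3).
    destruct (Hgamma (u, v) (HeU _ Huv)) as (B1 & B2 & B3).
    unfold psi. rewrite (path_integral_difference U w (gamma (x, y)) (gamma (u, v)) (x, y) e);
      rewrite ?A2, ?A3, ?B2, ?B3; auto.
    apply in_box_center, cond_pos. }
  assert (Hder : forall x y, U (x, y) ->
    is_derive (fun z => psi z y) x (P x y) /\ is_derive (fun z => psi x z) y (Q x y)).
  { intros x y Hxy. destruct (Hloc x y Hxy) as (e & HeU & Hpsi).
    assert (Hc : in_box (x, y) e (x, y)) by apply in_box_center, cond_pos.
    destruct (corner_integral_derive U P Q (x, y) e (x, y) x y) as [D1 D2]; auto.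
    assert (H0 : forall r, Rabs (r - r) < e)
      by (intros r; rewrite Rminus_diag, Rabs_R0; apply cond_pos).
    split.
    - apply (is_derive_ext_loc (fun z => psi x y + w (x, y) (z, y))).
      + exists e. intros z Hz. symmetry. apply Hpsi. split; [exact Hz|apply H0].
      + replace (P x y) with (0 + P x y) by ring.
        apply (is_derive_plus (K := R_AbsRing) (V := R_NormedModule)); [|exact D1].
        apply (is_derive_const (K := R_AbsRing) (V := R_NormedModule)).
    - apply (is_derive_ext_loc (fun z => psi x y + w (x, y) (x, z))).
      + exists e. intros z Hz. symmetry. apply Hpsi. split; [apply H0|exact Hz].
      + replace (Q x y) with (0 + Q x y) by ring.
        apply (is_derive_plus (K := R_AbsRing) (V := R_NormedModule)); [|exact D2].
        apply (is_derive_const (K := R_AbsRing) (V := R_NormedModule)). }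
  exists psi. split.
  - now apply (smooth_on_of_partials U psi P Q).
  - intros x y Hxy. destruct (Hder x y Hxy) as [D1 D2].
    split; apply is_derive_unique; assumption.
Qed.

(** * Circles and Moebius transformations *)

(** Circles and completed lines alike are the zero sets of the functions
    al (x^2 + y^2) + p x + q y + ga with p^2 + q^2 > 4 al ga. *)
Definition circle_equation (al p q ga : R) (P : xplane) : Prop :=
  match P with
  | Some (x, y) => al * (x ^ 2 + y ^ 2) + p * x + q * y + ga = 0
  | None => al = 0
  end.

Lemma circle_has_equation (C : xplane -> Prop) :
  circle C -> exists al p q ga, 0 < p ^ 2 + q ^ 2 - 4 * al * ga /\
    forall P, C P <-> circle_equation al p q ga P.
Proof.
  intros [(x0 & y0 & r & Hr & HC) | (p & q & c & Hpq & HC)].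
  - exists 1, (-2 * x0), (-2 * y0), (x0 ^ 2 + y0 ^ 2 - r ^ 2).
    split; [nra|]. intros P. rewrite HC. destruct P as [[x y]|]; simpl.
    + split; intros H; nra.
    + split; [tauto|lra].
  - exists 0, p, q, (- c). split.
    + assert (p <> 0 \/ q <> 0).
      { destruct (Req_dec p 0) as [->|]; [|now left].
        destruct (Req_dec q 0) as [->|]; [|now right]. now contradiction Hpq. }
      nra.
    + intros P. rewrite HC. destruct P as [[x y]|]; simpl; [|tauto].
      split; intros H; lra.
Qed.

Lemma equation_circle (C : xplane -> Prop) (al p q ga : R) :
  0 < p ^ 2 + q ^ 2 - 4 * al * ga -> (forall P, C P <-> circle_equation al p q ga P) ->
  circle C.
Proof.
  intros Hd HC. destruct (Req_dec al 0) as [Hal|Hal].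
  - right. exists p, q, (- ga). subst al. split.
    + intros E. injection E as -> ->. lra.
    + intros P. rewrite HC. destruct P as [[x y]|]; simpl; [|tauto].
      split; intros H; lra.
  - left. set (D := p ^ 2 + q ^ 2 - 4 * al * ga) in *.
    exists (- p / (2 * al)), (- q / (2 * al)), (sqrt (D / (4 * al ^ 2))).
    assert (H4 : 0 < 4 * al ^ 2) by (assert (0 < al ^ 2) by nra; lra).
    assert (HD : 0 < D / (4 * al ^ 2)) by now apply Rdiv_lt_0_compat.
    split; [now apply sqrt_lt_R0|].
    intros P. rewrite HC. destruct P as [[x y]|]; cbn [circle_equation]; [|tauto].
    rewrite pow2_sqrt by lra.
    assert (E : al * ((x - - p / (2 * al)) ^ 2 + (y - - q / (2 * al)) ^ 2 - D / (4 * al ^ 2))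
      = al * (x ^ 2 + y ^ 2) + p * x + q * y + ga)
      by (unfold D; field; exact Hal).
    split; intros H.
    + rewrite H in E. apply Rmult_integral in E. destruct E as [E|E]; [contradiction|lra].
    + rewrite <- E, H. unfold Rdiv. ring.
Qed.

Lemma moebius_intro (m m' : xplane -> xplane) :
  (forall P, m' (m P) = P) -> (forall P, m (m' P) = P) ->
  (forall al p q ga, 0 < p ^ 2 + q ^ 2 - 4 * al * ga ->
     exists al' p' q' ga', 0 < p' ^ 2 + q' ^ 2 - 4 * al' * ga' /\
       forall Q, circle_equation al p q ga (m' Q) <-> circle_equation al' p' q' ga' Q) ->
  moebius m.
Proof.
  intros H1 H2 H. split; [now exists m'|].
  intros C HC. destruct (circle_has_equation C HC) as (al & p & q & ga & Hd & HE).
  destruct (H al p q ga Hd) as (al' & p' & q' & ga' & Hd' & HE').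
  apply (equation_circle _ al' p' q' ga' Hd').
  intros Q. rewrite <- HE', <- HE. split.
  - intros (P & HP & <-). now rewrite H1.
  - intros HQ. exists (m' Q). now rewrite H2.
Qed.

Lemma moebius_compose (m n : xplane -> xplane) :
  moebius m -> moebius n -> moebius (fun P => n (m P)).
Proof.
  intros [(m' & M1 & M2) Mc] [(n' & N1 & N2) Nc]. split.
  - exists (fun P => m' (n' P)). split; intros P; [now rewrite N1|now rewrite M2].
  - intros C HC. assert (H := Nc _ (Mc C HC)).
    destruct (circle_has_equation _ H) as (al & p & q & ga & Hd & HE).
    apply (equation_circle _ al p q ga Hd). intros Q. rewrite <- HE. split.
    + intros (P & HP & <-). exists (m P). split; [|reflexivity]. now exists P.
    + intros (R & (P & HP & <-) & <-). now exists P.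
Qed.

Lemma sum_squares_zero (u v : R) : u ^ 2 + v ^ 2 = 0 -> u = 0 /\ v = 0.
Proof. intros H. split; nra. Qed.

Definition similarity (s a b : R) (P : xplane) : xplane :=
  match P with
  | Some (x, y) => Some (s * x + a, s * y + b)
  | None => None
  end.

Lemma moebius_similarity (s a b : R) : 0 < s -> moebius (similarity s a b).
Proof.
  intros Hs. apply moebius_intro with (similarity (/ s) (- a / s) (- b / s)).
  - intros [[x y]|]; simpl; [|reflexivity].
    do 2 f_equal; field; lra.
  - intros [[x y]|]; simpl; [|reflexivity].
    do 2 f_equal; field; lra.
  - intros al p q ga Hd.
    exists al, (s * p - 2 * al * a), (s * q - 2 * al * b),
      (al * (a ^ 2 + b ^ 2) - s * p * a - s * q * b + s ^ 2 * ga).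
    split.
    + replace (_ - _) with (s ^ 2 * (p ^ 2 + q ^ 2 - 4 * al * ga)) by ring.
      apply Rmult_lt_0_compat; [nra|exact Hd].
    + intros [[x y]|]; simpl; [|tauto].
      set (L := al * _ + _ + _ + _). set (L' := al * (x * (x * 1) + _) + _ + _ + _).
      assert (E : s ^ 2 * L = L') by (unfold L, L'; field; lra).
      assert (Hs2 : s ^ 2 <> 0) by nra.
      split; intros H.
      * rewrite <- E, H. ring.
      * rewrite H in E. apply Rmult_integral in E. tauto.
Qed.

Definition unit_inversion (P : xplane) : xplane :=
  match P with
  | Some (x, y) =>
      if Req_EM_T (x ^ 2 + y ^ 2) 0 then None
      else Some (x / (x ^ 2 + y ^ 2), y / (x ^ 2 + y ^ 2))
  | None => Some (0, 0)
  end.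

Lemma unit_inversion_involutive (P : xplane) : unit_inversion (unit_inversion P) = P.
Proof.
  destruct P as [[x y]|]; cbn [unit_inversion].
  - destruct (Req_EM_T (x ^ 2 + y ^ 2) 0) as [E|E]; cbn [unit_inversion].
    + apply sum_squares_zero in E. destruct E as [-> ->]. reflexivity.
    + set (rho := x ^ 2 + y ^ 2) in *.
      assert (E2 : (x / rho) ^ 2 + (y / rho) ^ 2 = / rho).
      { replace ((x / rho) ^ 2 + (y / rho) ^ 2) with (rho / rho ^ 2)
          by (unfold rho at 1; field; exact E).
        field. exact E. }
      rewrite E2. destruct (Req_EM_T (/ rho) 0) as [E'|E'].
      * exfalso. now apply (Rinv_neq_0_compat _ E).
      * do 2 f_equal; field; exact E.
  - destruct (Req_EM_T _ 0) as [E|E]; [reflexivity|]. exfalso. apply E. ring.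
Qed.

(** Multiplying the equation of a circle by the squared distance to the origin shows
    that inversion exchanges its outer coefficients. *)
Lemma moebius_unit_inversion : moebius unit_inversion.
Proof.
  apply moebius_intro with unit_inversion;
    [exact unit_inversion_involutive..|].
  intros al p q ga Hd. exists ga, p, q, al. split; [lra|].
  intros [[x y]|]; cbn [unit_inversion].
  - destruct (Req_EM_T (x ^ 2 + y ^ 2) 0) as [E|E]; cbn [circle_equation].
    + apply sum_squares_zero in E. destruct E as [-> ->]. lra.
    + set (rho := x ^ 2 + y ^ 2) in *.
      set (L := al * _ + _ + _ + _).
      assert (E2 : L * rho = ga * rho + p * x + q * y + al).
      { unfold L. replace ((x / rho) ^ 2 + (y / rho) ^ 2) with (rho / rho ^ 2)
          by (unfold rho at 1; field; exact E).
        field. exact E. }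
      split; intros H.
      * rewrite <- E2, H. ring.
      * rewrite H in E2. apply Rmult_integral in E2. tauto.
  - simpl. split; intros H; lra.
Qed.

(** * The Cauchy-Lipschitz theorem *)

Lemma pow_half_small (e : R) : 0 < e -> exists n, (/ 2) ^ n < e.
Proof.
  intros He. destruct (pow_lt_1_zero (/ 2)) with (y := e) as [n Hn].
  - rewrite Rabs_right; lra.
  - exact He.
  - exists n. assert (H := Hn n (le_n n)). apply Rle_lt_trans with (2 := H). apply Rle_abs.
Qed.

Lemma le_of_geometric_error (a b c : R) :
  0 <= c -> (forall n, a <= b + c * (/ 2) ^ n) -> a <= b.
Proof.
  intros Hc H. apply Rnot_lt_le. intros Hlt.
  assert (Hc1 : 0 < c + 1) by lra.
  destruct (pow_half_small ((a - b) / (c + 1))) as [n Hn].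
  { apply Rdiv_lt_0_compat; lra. }
  assert (Hp : 0 < (/ 2) ^ n) by (apply pow_lt; lra).
  assert (H2 : (/ 2) ^ n * (c + 1) < a - b).
  { replace (a - b) with ((a - b) / (c + 1) * (c + 1)) by (field; lra).
    now apply Rmult_lt_compat_r. }
  assert (H3 := H n). nra.
Qed.

Lemma geometric_steps_limit (x : nat -> R) (C : R) :
  (forall n, Rabs (x (S n) - x n) <= C * (/ 2) ^ n) ->
  forall n, Rabs (real (Lim_seq x) - x n) <= 2 * C * (/ 2) ^ n.
Proof.
  intros Hx.
  assert (HC : 0 <= C).
  { assert (H := Hx O). assert (H' := Rabs_pos (x 1%nat - x O)). simpl in H. lra. }
  assert (Hstep : forall n k, Rabs (x (n + k)%nat - x n) <= 2 * C * (/ 2) ^ n).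
  { intros n k.
    enough (H : Rabs (x (n + k)%nat - x n) <= 2 * C * (/ 2) ^ n * (1 - (/ 2) ^ k)).
    { assert (0 <= 2 * C * (/ 2) ^ n * (/ 2) ^ k)
        by (repeat apply Rmult_le_pos; try lra; apply pow_le; lra). lra. }
    induction k as [|k IH].
    - rewrite Nat.add_0_r, Rminus_diag, Rabs_R0. simpl. lra.
    - rewrite <- plus_n_Sm.
      replace (x (S (n + k)) - x n) with ((x (S (n + k)) - x (n + k)%nat) + (x (n + k)%nat - x n))
        by ring.
      apply Rle_trans with (1 := Rabs_triang _ _).
      assert (H := Hx (n + k)%nat). rewrite pow_add in H. simpl. nra. }
  assert (Hfin : ex_finite_lim_seq x).
  { apply ex_lim_seq_cauchy_corr. intros e.
    destruct (pow_half_small (e / (4 * C + 1))) as [N HN].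
    { apply Rdiv_lt_0_compat; [apply cond_pos|lra]. }
    assert (HN' : (4 * C + 1) * (/ 2) ^ N < e).
    { replace (pos e) with ((4 * C + 1) * (e / (4 * C + 1))) by (field; lra).
      apply Rmult_lt_compat_l; lra. }
    assert (HpN : 0 < (/ 2) ^ N) by (apply pow_lt; lra).
    exists N. intros n m Hn Hm.
    replace n with (N + (n - N))%nat by lia. replace m with (N + (m - N))%nat by lia.
    assert (A := Hstep N (n - N)%nat). assert (B := Hstep N (m - N)%nat).
    replace (_ - _) with ((x (N + (n - N))%nat - x N) + - (x (N + (m - N))%nat - x N)) by ring.
    apply Rle_lt_trans with (1 := Rabs_triang _ _). rewrite Rabs_Ropp. lra. }
  destruct Hfin as [l Hl]. rewrite (is_lim_seq_unique _ _ Hl). simpl.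
  intros n.
  apply (is_lim_seq_le (fun k => Rabs (x (n + k)%nat - x n)) (fun _ => 2 * C * (/ 2) ^ n)
    (Rabs (l - x n)) (2 * C * (/ 2) ^ n)).
  - intros k. apply Hstep.
  - apply (is_lim_seq_abs _ (Finite (l - x n))).
    apply (is_lim_seq_minus' _ _ l (x n)); [|apply is_lim_seq_const].
    apply (is_lim_seq_ext (fun k => x (k + n)%nat)).
    + intros k. f_equal. lia.
    + now apply is_lim_seq_incr_n.
  - apply is_lim_seq_const.
Qed.

Lemma RInt_abs_le (g : R -> R) (a b K : R) :
  (forall t, continuous g t) ->
  (forall t, Rmin a b <= t <= Rmax a b -> Rabs (g t) <= K) ->
  Rabs (RInt g a b) <= K * Rabs (b - a).
Proof.
  intros Hc HK.
  assert (Hex : forall a b, ex_RInt g a b)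
    by (intros; apply (ex_RInt_continuous (V := R_CompleteNormedModule)); auto).
  destruct (Rle_dec a b) as [H|H].
  - rewrite Rmin_left, Rmax_right in HK by lra. rewrite (Rabs_right (b - a)) by lra.
    rewrite Rmult_comm. now apply abs_RInt_le_const.
  - rewrite Rmin_right, Rmax_left in HK by lra. rewrite (Rabs_left (b - a)) by lra.
    rewrite <- opp_RInt_swap by apply Hex. unfold opp; simpl. rewrite Rabs_Ropp.
    replace (K * - (b - a)) with ((a - b) * K) by ring.
    apply abs_RInt_le_const; auto. lra.
Qed.

(** Systems are indexed by an arbitrary type; hypotheses and conclusions are uniform in
    the index, which replaces a norm. *)
Definition lipschitz_field {I : Type} (f : (I -> R) -> I -> R) (L : R) : Prop :=
  forall p q d j, (forall i, Rabs (p i - q i) <= d) -> Rabs (f p j - f q j) <= L * d.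

Definition picard_step {I : Type} (f : (I -> R) -> I -> R) (p0 : I -> R)
    (v : R -> I -> R) (t : R) (j : I) : R :=
  p0 j + RInt (fun s => f (v s) j) 0 t.


Definition lipschitz_curve {I : Type} (K : R) (v : R -> I -> R) : Prop :=
  forall s t j, Rabs (v s j - v t j) <= K * Rabs (s - t).

Lemma continuous_field_along {I : Type} (f : (I -> R) -> I -> R) (L K : R)
    (v : R -> I -> R) (j : I) (t : R) :
  lipschitz_field f L -> lipschitz_curve K v -> continuous (fun s => f (v s) j) t.
Proof.
  intros Hf Hv. apply (lipschitz_continuous _ (L * K)). intros s.
  rewrite Rmult_assoc. apply Hf. intros i. apply Hv.
Qed.

Lemma picard_step_lipschitz {I : Type} (f : (I -> R) -> I -> R) (p0 : I -> R) (L K : R)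
    (v : R -> I -> R) :
  lipschitz_field f L -> (forall p j, Rabs (f p j) <= K) -> lipschitz_curve K v ->
  lipschitz_curve K (picard_step f p0 v).
Proof.
  intros Hf HK Hv s t j. unfold picard_step.
  assert (Hc : forall t, continuous (fun s => f (v s) j) t)
    by (intros; now apply (continuous_field_along f L K)).
  assert (Hex : forall a b, ex_RInt (fun s => f (v s) j) a b)
    by (intros; apply (ex_RInt_continuous (V := R_CompleteNormedModule)); auto).
  assert (E := RInt_Chasles (fun s => f (v s) j) 0 t s (Hex _ _) (Hex _ _)).
  unfold plus in E; simpl in E. rewrite <- E.
  apply Rle_trans with (Rabs (RInt (fun s => f (v s) j) t s)).
  - right. f_equal. ring.
  - apply RInt_abs_le; auto.
Qed.

Lemma picard_step_contraction {I : Type} (f : (I -> R) -> I -> R) (p0 : I -> R) (L K r d : R)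
    (v w : R -> I -> R) :
  0 < L -> 0 <= d -> lipschitz_field f L -> lipschitz_curve K v -> lipschitz_curve K w ->
  L * r <= / 2 ->
  (forall t j, Rabs t <= r -> Rabs (v t j - w t j) <= d) ->
  forall t j, Rabs t <= r ->
    Rabs (picard_step f p0 v t j - picard_step f p0 w t j) <= / 2 * d.
Proof.
  intros HL Hd Hf Hv Hw Hr Hvw t j Ht. unfold picard_step.
  assert (Cv : forall t, continuous (fun s => f (v s) j) t)
    by (intros; now apply (continuous_field_along f L K)).
  assert (Cw : forall t, continuous (fun s => f (w s) j) t)
    by (intros; now apply (continuous_field_along f L K)).
  assert (Ev : ex_RInt (fun s => f (v s) j) 0 t)
    by (apply (ex_RInt_continuous (V := R_CompleteNormedModule)); auto).
  assert (Ew : ex_RInt (fun s => f (w s) j) 0 t)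
    by (apply (ex_RInt_continuous (V := R_CompleteNormedModule)); auto).
  replace (_ - _) with (RInt (fun s => f (v s) j) 0 t - RInt (fun s => f (w s) j) 0 t) by ring.
  assert (E := RInt_minus _ _ _ _ Ev Ew). unfold minus, plus, opp in E; simpl in E.
  unfold Rminus. rewrite <- E.
  apply Rle_trans with (L * d * Rabs (t - 0)).
  - apply RInt_abs_le.
    + intros s. apply (continuous_minus (V := R_NormedModule)); auto.
    + intros s Hs. apply Hf. intros i. apply Hvw.
      apply Rle_trans with (2 := Ht).
      revert Hs. unfold Rmin, Rmax, Rabs.
      destruct (Rle_dec 0 t); destruct (Rcase_abs s); destruct (Rcase_abs t); lra.
  - rewrite Rminus_0_r. assert (H := Rabs_pos t).
    replace (L * d * Rabs t) with (d * (L * Rabs t)) by ring.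
    rewrite (Rmult_comm (/ 2)). apply Rmult_le_compat_l; [exact Hd|]. nra.
Qed.

(** Picard iteration converges on the interval of radius 1 / (2 L), the integral operator
    being there a contraction with factor 1 / 2. *)
Lemma cauchy_lipschitz {I : Type} (f : (I -> R) -> I -> R) (p0 : I -> R) (L K : R) :
  0 < L -> 0 <= K -> lipschitz_field f L -> (forall p j, Rabs (f p j) <= K) ->
  exists u : R -> I -> R,
    (forall j, u 0 j = p0 j) /\ lipschitz_curve K u /\
    forall t j, Rabs t < / (2 * L) -> is_derive (fun s => u s j) t (f (u t) j).
Proof.
  intros HL HK Hf HfK.
  set (r := / (2 * L)).
  assert (Hr : L * r = / 2) by (unfold r; field; lra).
  assert (Hr0 : 0 < r) by (apply Rinv_0_lt_compat; lra).
  set (x := fix x n := match n with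
                       | O => fun (_ : R) j => p0 j
                       | S n => picard_step f p0 (x n)
                       end).
  assert (Hx : forall n, lipschitz_curve K (x n)).
  { induction n as [|n IH].
    - intros s t j. simpl. rewrite Rminus_diag, Rabs_R0.
      apply Rmult_le_pos; [exact HK|apply Rabs_pos].
    - now apply (picard_step_lipschitz f p0 L). }
  set (C := K * r).
  assert (HC : 0 <= C) by (apply Rmult_le_pos; lra).
  assert (Hhalf : forall n, 0 <= (/ 2) ^ n) by (intros; apply pow_le; lra).
  assert (Hdiff : forall n t j, Rabs t <= r -> Rabs (x (S n) t j - x n t j) <= C * (/ 2) ^ n).
  { induction n as [|n IH]; intros t j Ht.
    - assert (H := Hx 1%nat t 0 j).
      replace (x 1%nat 0 j) with (p0 j) in H.
      2: { cbn. unfold picard_step. rewrite RInt_point. unfold zero; simpl. ring. }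
      rewrite Rminus_0_r in H. apply Rle_trans with (1 := H). unfold C. simpl. nra.
    - replace (C * (/ 2) ^ S n) with (/ 2 * (C * (/ 2) ^ n)) by (simpl; ring).
      apply (picard_step_contraction f p0 L K r _ (x (S n)) (x n)); auto; [|lra].
      apply Rmult_le_pos; auto. }
  set (u := fun t j => real (Lim_seq (fun n => x n (clamp (- r) r t) j))).
  assert (Hclamp : forall t, Rabs (clamp (- r) r t) <= r).
  { intros t. apply Rabs_le. apply clamp_in. lra. }
  assert (Hu : forall n t j, Rabs (u t j - x n (clamp (- r) r t) j) <= 2 * C * (/ 2) ^ n).
  { intros n t j. unfold u.
    apply (geometric_steps_limit (fun n => x n (clamp (- r) r t) j) C).
    intros k. now apply Hdiff. }
  assert (HuK : lipschitz_curve K u).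
  { intros s t j. apply le_of_geometric_error with (4 * C); [lra|]. intros n.
    assert (A := Hu n s j). assert (B := Hu n t j).
    assert (D := Hx n (clamp (- r) r s) (clamp (- r) r t) j).
    assert (E := clamp_lipschitz (- r) r s t).
    set (xs := x n (clamp (- r) r s) j) in *. set (xt := x n (clamp (- r) r t) j) in *.
    replace (u s j - u t j) with ((u s j - xs) + (- (u t j - xt) + (xs - xt))) by ring.
    apply Rle_trans with (1 := Rabs_triang _ _).
    assert (F := Rabs_triang (- (u t j - xt)) (xs - xt)). rewrite Rabs_Ropp in F.
    assert (G : K * Rabs (clamp (- r) r s - clamp (- r) r t) <= K * Rabs (s - t))
      by now apply Rmult_le_compat_l.
    lra. }
  assert (Hfix : forall t j, Rabs t <= r -> u t j = picard_step f p0 u t j).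
  { intros t j Ht.
    assert (Hid : forall t, Rabs t <= r -> clamp (- r) r t = t).
    { intros s Hs. apply clamp_id. now apply Rabs_le_between. }
    enough (H : Rabs (u t j - picard_step f p0 u t j) <= 0).
    { assert (H' := Rabs_pos (u t j - picard_step f p0 u t j)).
      apply Rminus_diag_uniq. apply Rabs_eq_0. lra. }
    apply le_of_geometric_error with (2 * C); [lra|]. intros n.
    assert (A := Hu (S n) t j). rewrite Hid in A by exact Ht.
    assert (B : Rabs (picard_step f p0 (x n) t j - picard_step f p0 u t j)
      <= / 2 * (2 * C * (/ 2) ^ n)).
    { apply (picard_step_contraction f p0 L K r _ (x n) u); auto; [|lra|].
      - assert (H := Hhalf n). nra.
      - intros s i Hs. rewrite Rabs_minus_sym. assert (H := Hu n s i).
        now rewrite Hid in H. }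
    replace (u t j - picard_step f p0 u t j)
      with ((u t j - x (S n) t j) + (picard_step f p0 (x n) t j - picard_step f p0 u t j))
      by (simpl; ring).
    apply Rle_trans with (1 := Rabs_triang _ _). simpl pow in A. lra. }
  exists u. split; [|split; [exact HuK|]].
  - intros j. rewrite Hfix by (rewrite Rabs_R0; lra).
    unfold picard_step. rewrite RInt_point. unfold zero; simpl. ring.
  - intros t j Ht. fold r in Ht.
    apply (is_derive_ext_loc (fun s => picard_step f p0 u s j)).
    + generalize (locally_in_interval t 0 r). rewrite Rminus_0_r. intros H.
      generalize (H Ht). apply filter_imp. intros s Hs. rewrite Rminus_0_r in Hs.
      symmetry. apply Hfix. lra.
    + unfold picard_step. replace (f (u t) j) with (0 + f (u t) j) by ring.
      apply (is_derive_plus (K := R_AbsRing) (V := R_NormedModule)).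
      * apply (is_derive_const (K := R_AbsRing) (V := R_NormedModule)).
      * apply (is_derive_RInt (fun s => f (u s) j) _ 0).
        -- apply filter_forall. intros b.
           apply (RInt_correct (V := R_CompleteNormedModule)).
           apply (ex_RInt_continuous (V := R_CompleteNormedModule)). intros s _.
           now apply (continuous_field_along f L K).
        -- now apply (continuous_field_along f L K).
Qed.

(** * Curves of prescribed curvature *)

Lemma derive_bound_lipschitz (f df : R -> R) (a b m : R) :
  (forall t, Rmin a b <= t <= Rmax a b -> is_derive f t (df t) /\ Rabs (df t) <= m) ->
  Rabs (f b - f a) <= m * Rabs (b - a).
Proof.
  intros H. destruct (MVT_gen f a b df) as (c & Hc & E).
  - intros t Ht. apply H. lra.
  - intros t Ht. apply derivable_continuous_pt. exists (df t).
    apply is_derive_Reals. now apply H.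
  - rewrite E, Rabs_mult. apply Rmult_le_compat_r; [apply Rabs_pos|]. now apply H.
Qed.

Lemma cos_lipschitz (s t : R) : Rabs (cos s - cos t) <= Rabs (s - t).
Proof.
  rewrite <- (Rmult_1_l (Rabs (s - t))).
  apply (derive_bound_lipschitz cos (fun t => - sin t)). intros u _. split.
  - apply is_derive_cos.
  - rewrite Rabs_Ropp. apply Rabs_le, SIN_bound.
Qed.

Lemma sin_lipschitz (s t : R) : Rabs (sin s - sin t) <= Rabs (s - t).
Proof.
  rewrite <- (Rmult_1_l (Rabs (s - t))).
  apply (derive_bound_lipschitz sin cos). intros u _. split.
  - apply is_derive_sin.
  - apply Rabs_le, COS_bound.
Qed.

Lemma continuity_2d_pt_bounded (f : R -> R -> R) (x y : R) :
  continuity_2d_pt f x y ->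
  exists m, 0 <= m /\ locally_2d (fun u v => Rabs (f u v) <= m) x y.
Proof.
  intros Hf. exists (Rabs (f x y) + 1). split.
  - assert (H := Rabs_pos (f x y)). lra.
  - generalize (Hf (mkposreal 1 Rlt_0_1)). apply locally_2d_impl, locally_2d_forall.
    simpl. intros u v H.
    replace (f u v) with ((f u v - f x y) + f x y) by ring.
    apply Rle_trans with (1 := Rabs_triang _ _). lra.
Qed.

Lemma smooth_on_locally_lipschitz (D : R * R -> Prop) (f : R -> R -> R) (x0 y0 : R) :
  open D -> smooth_on D f -> D (x0, y0) ->
  exists m : R, 0 <= m /\ exists e : posreal, forall x y x' y',
    Rabs (x - x0) < e -> Rabs (y - y0) < e -> Rabs (x' - x0) < e -> Rabs (y' - y0) < e ->
    D (x, y) /\ Rabs (f x y) <= m /\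
    Rabs (f x y - f x' y') <= m * (Rabs (x - x') + Rabs (y - y')).
Proof.
  intros HD Hf H0.
  destruct (continuity_2d_pt_bounded f x0 y0) as (m0 & P0 & B0);
    [now apply (smooth_on_continuity D)|].
  destruct (continuity_2d_pt_bounded (d_x f) x0 y0) as (m1 & P1 & B1);
    [now apply (smooth_on_continuity D); [apply smooth_on_d_x|]|].
  destruct (continuity_2d_pt_bounded (d_y f) x0 y0) as (m2 & P2 & B2);
    [now apply (smooth_on_continuity D); [apply smooth_on_d_y|]|].
  exists (m0 + m1 + m2). split; [lra|].
  destruct (locally_2d_and _ _ _ _ (open_locally_2d D x0 y0 HD H0)
    (locally_2d_and _ _ _ _ B0 (locally_2d_and _ _ _ _ B1 B2))) as [e He].
  exists e. intros x y x' y' Hx Hy Hx' Hy'.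
  destruct (He x y Hx Hy) as (K1 & K2 & _ & _).
  split; [exact K1|]. split; [lra|].
  replace (f x y - f x' y') with ((f x y - f x' y) + (f x' y - f x' y')) by ring.
  apply Rle_trans with (1 := Rabs_triang _ _).
  assert (A : Rabs (f x y - f x' y) <= m1 * Rabs (x - x')).
  { apply (derive_bound_lipschitz (fun z => f z y) (fun z => d_x f z y)).
    intros t Ht. destruct (He t y) as (T1 & _ & T2 & _); [|exact Hy|].
    - now apply between_in_box with x' x.
    - split; [now apply (smooth_on_is_derive_x D)|exact T2]. }
  assert (B : Rabs (f x' y - f x' y') <= m2 * Rabs (y - y')).
  { apply (derive_bound_lipschitz (fun z => f x' z) (fun z => d_y f x' z)).
    intros t Ht. destruct (He x' t) as (T1 & _ & _ & T2); [exact Hx'| |].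
    - now apply between_in_box with y' y.
    - split; [now apply (smooth_on_is_derive_y D)|exact T2]. }
  assert (Q1 := Rabs_pos (x - x')). assert (Q2 := Rabs_pos (y - y')). nra.
Qed.

Inductive coordinate := coord_x | coord_y | coord_angle.

Lemma product_lipschitz (a a' c c' m d1 d2 : R) :
  Rabs (a - a') <= d1 -> Rabs (c - c') <= d2 -> Rabs a' <= m -> Rabs c <= 1 ->
  Rabs (a * c - a' * c') <= d1 + m * d2.
Proof.
  intros H1 H2 H3 H4.
  replace (a * c - a' * c') with ((a - a') * c + a' * (c - c')) by ring.
  apply Rle_trans with (1 := Rabs_triang _ _). rewrite !Rabs_mult.
  assert (P1 := Rabs_pos (a - a')). assert (P2 := Rabs_pos (c - c')).
  assert (P3 := Rabs_pos a'). nra.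
Qed.

(** Curves of unit speed whose curvature is prescribed as a function of the point and the
    direction; the coefficients are cut off outside a box to make the system globally
    Lipschitz. *)
Lemma prescribed_curvature (D : R * R -> Prop) (A B C : R -> R -> R) (x0 y0 th0 : R) :
  open D -> smooth_on D A -> smooth_on D B -> smooth_on D C -> D (x0, y0) ->
  exists (X Y Th : R -> R) (r : R), 0 < r /\ X 0 = x0 /\ Y 0 = y0 /\ Th 0 = th0 /\
    forall t, Rabs t < r ->
      D (X t, Y t) /\ is_derive X t (cos (Th t)) /\ is_derive Y t (sin (Th t)) /\
      is_derive Th t (A (X t) (Y t) * cos (Th t) + B (X t) (Y t) * sin (Th t) + C (X t) (Y t)).
Proof.
  intros HD HA HB HC H0.
  destruct (smooth_on_locally_lipschitz D A x0 y0 HD HA H0) as (ma & Pa & ea & La).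
  destruct (smooth_on_locally_lipschitz D B x0 y0 HD HB H0) as (mb & Pb & eb & Lb).
  destruct (smooth_on_locally_lipschitz D C x0 y0 HD HC H0) as (mc & Pc & ec & Lc).
  set (e := Rmin ea (Rmin eb ec) / 2).
  assert (He : 0 < e /\ e < ea /\ e < eb /\ e < ec).
  { assert (Q1 := cond_pos ea). assert (Q2 := cond_pos eb). assert (Q3 := cond_pos ec).
    assert (Hm : 0 < Rmin ea (Rmin eb ec)) by (repeat apply Rmin_pos; assumption).
    assert (M1 := Rmin_l ea (Rmin eb ec)). assert (M2 := Rmin_r ea (Rmin eb ec)).
    assert (M3 := Rmin_l eb ec). assert (M4 := Rmin_r eb ec).
    unfold e. lra. }
  destruct He as (He & Hea & Heb & Hec).
  set (cx := fun p : coordinate -> R => clamp (x0 - e) (x0 + e) (p coord_x)).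
  set (cy := fun p : coordinate -> R => clamp (y0 - e) (y0 + e) (p coord_y)).
  assert (Hcx : forall p, Rabs (cx p - x0) <= e).
  { intros p. assert (H := clamp_in (x0 - e) (x0 + e) (p coord_x) ltac:(lra)).
    apply Rabs_le. fold (cx p) in H. lra. }
  assert (Hcy : forall p, Rabs (cy p - y0) <= e).
  { intros p. assert (H := clamp_in (y0 - e) (y0 + e) (p coord_y) ltac:(lra)).
    apply Rabs_le. fold (cy p) in H. lra. }
  set (f := fun (p : coordinate -> R) (j : coordinate) =>
    match j with
    | coord_x => cos (p coord_angle)
    | coord_y => sin (p coord_angle)
    | coord_angle => A (cx p) (cy p) * cos (p coord_angle)
                     + B (cx p) (cy p) * sin (p coord_angle) + C (cx p) (cy p)
    end).
  set (p0 := fun j => match j with coord_x => x0 | coord_y => y0 | coord_angle => th0 end).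
  assert (Hloc : forall p q d, (forall i, Rabs (p i - q i) <= d) ->
    Rabs (cx p - cx q) + Rabs (cy p - cy q) <= 2 * d).
  { intros p q d Hd.
    assert (E1 := clamp_lipschitz (x0 - e) (x0 + e) (p coord_x) (q coord_x)).
    assert (E2 := clamp_lipschitz (y0 - e) (y0 + e) (p coord_y) (q coord_y)).
    assert (E3 := Hd coord_x). assert (E4 := Hd coord_y). unfold cx, cy. lra. }
  assert (Hcos : forall t, Rabs (cos t) <= 1) by (intros; apply Rabs_le, COS_bound).
  assert (Hsin : forall t, Rabs (sin t) <= 1) by (intros; apply Rabs_le, SIN_bound).
  set (L := 1 + 3 * ma + 3 * mb + 2 * mc). set (K := 1 + ma + mb + mc).
  assert (Hf : lipschitz_field f L).
  { intros p q d j Hd.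
    assert (Pd : 0 <= d) by (apply Rle_trans with (2 := Hd coord_x), Rabs_pos).
    assert (Hth := Hd coord_angle). assert (Hxy := Hloc p q d Hd).
    assert (Ecos := cos_lipschitz (p coord_angle) (q coord_angle)).
    assert (Esin := sin_lipschitz (p coord_angle) (q coord_angle)).
    assert (Q1 := Hcx p). assert (Q2 := Hcy p). assert (Q3 := Hcx q). assert (Q4 := Hcy q).
    destruct j; simpl.
    - unfold L. nra.
    - unfold L. nra.
    - destruct (La (cx p) (cy p) (cx q) (cy q)) as (_ & _ & A1); [lra..|].
      destruct (Lb (cx p) (cy p) (cx q) (cy q)) as (_ & _ & B1); [lra..|].
      destruct (Lc (cx p) (cy p) (cx q) (cy q)) as (_ & _ & C1); [lra..|].
      destruct (La (cx q) (cy q) (cx q) (cy q)) as (_ & A2 & _); [lra..|].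
      destruct (Lb (cx q) (cy q) (cx q) (cy q)) as (_ & B2 & _); [lra..|].
      assert (A3 : Rabs (A (cx p) (cy p) - A (cx q) (cy q)) <= ma * (2 * d)) by nra.
      assert (B3 : Rabs (B (cx p) (cy p) - B (cx q) (cy q)) <= mb * (2 * d)) by nra.
      assert (C3 : Rabs (C (cx p) (cy p) - C (cx q) (cy q)) <= mc * (2 * d)) by nra.
      assert (A4 := product_lipschitz _ _ _ _ ma _ d A3 (Rle_trans _ _ _ Ecos Hth) A2 (Hcos _)).
      assert (B4 := product_lipschitz _ _ _ _ mb _ d B3 (Rle_trans _ _ _ Esin Hth) B2 (Hsin _)).
      apply Rabs_le_between in A4. apply Rabs_le_between in B4. apply Rabs_le_between in C3.
      unfold L. apply Rabs_le. lra. }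
  assert (HK : forall p j, Rabs (f p j) <= K).
  { intros p j. assert (Q1 := Hcx p). assert (Q2 := Hcy p). unfold K.
    assert (Q5 := Hcos (p coord_angle)). assert (Q6 := Hsin (p coord_angle)).
    destruct j; simpl; [lra..|].
    destruct (La (cx p) (cy p) (cx p) (cy p)) as (_ & A2 & _); [lra..|].
    destruct (Lb (cx p) (cy p) (cx p) (cy p)) as (_ & B2 & _); [lra..|].
    destruct (Lc (cx p) (cy p) (cx p) (cy p)) as (_ & C2 & _); [lra..|].
    apply Rle_trans with (1 := Rabs_triang _ _).
    assert (T := Rabs_triang (A (cx p) (cy p) * cos (p coord_angle))
      (B (cx p) (cy p) * sin (p coord_angle))).
    rewrite !Rabs_mult in T.
    assert (Z1 := Rabs_pos (A (cx p) (cy p))). assert (Z2 := Rabs_pos (B (cx p) (cy p))).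
    nra. }
  destruct (cauchy_lipschitz f p0 L K) as (u & U0 & UL & Ud); auto; [unfold L; lra|unfold K; lra|].
  assert (HKp : 0 < K) by (unfold K; lra).
  assert (HLp : 0 < / (2 * L)) by (apply Rinv_0_lt_compat; unfold L; lra).
  assert (HeK : 0 < e / K) by now apply Rdiv_lt_0_compat.
  exists (fun t => u t coord_x), (fun t => u t coord_y), (fun t => u t coord_angle),
    (Rmin (/ (2 * L)) (e / K)).
  split; [now apply Rmin_pos|].
  split; [apply (U0 coord_x)|]. split; [apply (U0 coord_y)|]. split; [apply (U0 coord_angle)|].
  intros t Ht.
  assert (Ht1 : Rabs t < / (2 * L)) by (apply Rlt_le_trans with (1 := Ht), Rmin_l).
  assert (Ht2 : K * Rabs t < e).
  { replace e with (K * (e / K)) by (field; lra). apply Rmult_lt_compat_l; [exact HKp|].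
    apply Rlt_le_trans with (1 := Ht), Rmin_r. }
  assert (Bx := UL t 0 coord_x). assert (By := UL t 0 coord_y).
  rewrite U0, Rminus_0_r in Bx, By. simpl in Bx, By.
  assert (Ix : cx (u t) = u t coord_x).
  { apply clamp_id. apply Rle_trans with (r3 := e) in Bx; [|lra].
    apply Rabs_le_between in Bx. lra. }
  assert (Iy : cy (u t) = u t coord_y).
  { apply clamp_id. apply Rle_trans with (r3 := e) in By; [|lra].
    apply Rabs_le_between in By. lra. }
  split; [|split; [|split]].
  - apply (La _ _ (u t coord_x) (u t coord_y)); lra.
  - exact (Ud t coord_x Ht1).
  - exact (Ud t coord_y Ht1).
  - assert (H := Ud t coord_angle Ht1). simpl in H. rewrite Ix, Iy in H. exact H.
Qed.

(** * Geodesics of Randers metrics *)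

Lemma is_derive_value (f : R -> R) (t l l' : R) : is_derive f t l -> l = l' -> is_derive f t l'.
Proof. now intros H <-. Qed.

Lemma locally_zero_derive (f : R -> R) (r t l : R) :
  Rabs t < r -> (forall s, Rabs s < r -> f s = 0) -> is_derive f t l -> l = 0.
Proof.
  intros Ht Hf Hl. rewrite <- (is_derive_unique _ _ _ Hl).
  rewrite (Derive_ext_loc f (fun _ => 0)); [apply Derive_const|].
  rewrite <- (Rminus_0_r t) in Ht.
  generalize (locally_in_interval t 0 r Ht). apply filter_imp.
  intros s Hs. apply Hf. now rewrite <- (Rminus_0_r s).
Qed.

Lemma is_derive_frame (al be ga th : R -> R) (t al' be' ga' th' : R) :
  is_derive al t al' -> is_derive be t be' -> is_derive ga t ga' -> is_derive th t th' ->
  is_derive (fun s => al s * cos (th s) + be s * sin (th s) + ga s) t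
    (al' * cos (th t) + be' * sin (th t) + ga'
     + th' * (be t * cos (th t) - al t * sin (th t))).
Proof.
  intros H1 H2 H3 H4. eapply is_derive_value.
  - auto_derive.
    + repeat split; eexists; eassumption.
    + reflexivity.
  - rewrite (is_derive_unique (fun s : R => al s) _ _ H1), (is_derive_unique (fun s : R => be s) _ _ H2),
      (is_derive_unique (fun s : R => ga s) _ _ H3), (is_derive_unique (fun s : R => th s) _ _ H4).
    ring.
Qed.

(** Along a unit-speed curve on the circle with equation
    al (x^2 + y^2) + p x + q y + ga = 0, the gradient (2 al x + p, 2 al y + q) of the
    equation is normal to the curve, of constant length, and the curvature is -2 al over
    its component on the unit normal. *)
Lemma circle_curvature_constant (C : xplane -> Prop) (X Y Th ka : R -> R) (r ka' : R) :
  circle C -> 0 < r -> (forall t, Rabs t < r -> C (Some (X t, Y t))) ->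
  (forall t, Rabs t < r ->
     is_derive X t (cos (Th t)) /\ is_derive Y t (sin (Th t)) /\ is_derive Th t (ka t)) ->
  is_derive ka 0 ka' -> ka' = 0.
Proof.
  intros HC Hr HXY Hd Hka.
  destruct (circle_has_equation C HC) as (al & p & q & ga & Hdisc & HE).
  assert (Hcs : forall t, cos (Th t) ^ 2 + sin (Th t) ^ 2 = 1).
  { intros t. assert (H := sin2_cos2 (Th t)). unfold Rsqr in H. lra. }
  assert (E0 : forall t, Rabs t < r -> al * (X t ^ 2 + Y t ^ 2) + p * X t + q * Y t + ga = 0).
  { intros t Ht. exact (proj1 (HE _) (HXY t Ht)). }
  assert (Gx : forall t, Rabs t < r -> is_derive (fun s => 2 * al * X s + p) t (2 * al * cos (Th t))).
  { intros t Ht. destruct (Hd t Ht) as (H1 & _ & _). eapply is_derive_value.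
    - auto_derive; [eexists; eassumption|reflexivity].
    - rewrite (is_derive_unique (fun s : R => X s) _ _ H1). ring. }
  assert (Gy : forall t, Rabs t < r -> is_derive (fun s => 2 * al * Y s + q) t (2 * al * sin (Th t))).
  { intros t Ht. destruct (Hd t Ht) as (_ & H1 & _). eapply is_derive_value.
    - auto_derive; [eexists; eassumption|reflexivity].
    - rewrite (is_derive_unique (fun s : R => Y s) _ _ H1). ring. }
  assert (E1 : forall t, Rabs t < r ->
    (2 * al * X t + p) * cos (Th t) + (2 * al * Y t + q) * sin (Th t) + 0 = 0).
  { intros t Ht. destruct (Hd t Ht) as (H1 & H2 & _).
    apply (locally_zero_derive _ r t _ Ht E0). eapply is_derive_value.
    - auto_derive; [repeat split; eexists; eassumption|reflexivity].
    - rewrite (is_derive_unique (fun s : R => X s) _ _ H1), (is_derive_unique (fun s : R => Y s) _ _ H2).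
      ring. }
  set (nu := fun t => (2 * al * Y t + q) * cos (Th t) + - (2 * al * X t + p) * sin (Th t) + 0).
  assert (Hnu : forall t, Rabs t < r -> is_derive nu t 0).
  { intros t Ht. destruct (Hd t Ht) as (H1 & H2 & H3).
    eapply is_derive_value.
    - apply is_derive_frame.
      + now apply Gy.
      + apply (is_derive_opp (K := R_AbsRing) (V := R_NormedModule)). now apply Gx.
      + apply (is_derive_const (K := R_AbsRing) (V := R_NormedModule)).
      + exact H3.
    - unfold opp, zero; simpl. assert (E := E1 t Ht).
      replace (_ + _) with (- ka t * ((2 * al * X t + p) * cos (Th t)
        + (2 * al * Y t + q) * sin (Th t) + 0)) by ring.
      rewrite E. ring. }
  assert (E2 : forall t, Rabs t < r -> 2 * al + ka t * nu t = 0).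
  { intros t Ht. destruct (Hd t Ht) as (H1 & H2 & H3).
    apply (locally_zero_derive _ r t _ Ht E1). eapply is_derive_value.
    - apply is_derive_frame.
      + now apply Gx.
      + now apply Gy.
      + apply (is_derive_const (K := R_AbsRing) (V := R_NormedModule)).
      + exact H3.
    - transitivity (2 * al * (cos (Th t) ^ 2 + sin (Th t) ^ 2) + ka t * nu t).
      + unfold nu, zero; simpl. ring.
      + rewrite Hcs. ring. }
  assert (H0 : Rabs 0 < r) by now rewrite Rabs_R0.
  assert (E3 : ka' * nu 0 = 0).
  { apply (locally_zero_derive _ r 0 _ H0 E2). eapply is_derive_value.
    - auto_derive; [repeat split; eexists; [exact Hka|now apply Hnu]|reflexivity].
    - rewrite (is_derive_unique (fun s : R => ka s) _ _ Hka),
        (is_derive_unique (fun s : R => nu s) _ _ (Hnu 0 H0)). ring. }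
  apply Rmult_integral in E3. destruct E3 as [E3|E3]; [exact E3|exfalso].
  assert (F0 := E0 0 H0). assert (F1 := E1 0 H0). assert (F2 := Hcs 0).
  unfold nu in E3.
  set (c := cos (Th 0)) in *. set (s := sin (Th 0)) in *.
  set (gx := 2 * al * X 0 + p) in *. set (gy := 2 * al * Y 0 + q) in *.
  assert (G1 : (gx ^ 2 + gy ^ 2) * (c ^ 2 + s ^ 2) = (gx * c + gy * s + 0) ^ 2 + (gy * c + - gx * s + 0) ^ 2)
    by ring.
  rewrite F1, E3, F2 in G1.
  assert (G2 : gx ^ 2 + gy ^ 2 = 4 * al * (al * (X 0 ^ 2 + Y 0 ^ 2) + p * X 0 + q * Y 0 + ga)
    + (p ^ 2 + q ^ 2 - 4 * al * ga)) by (unfold gx, gy; ring).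
  rewrite F0 in G2. lra.
Qed.

Lemma randers_pd3 (phi a b : R -> R -> R) (x y u v : R) :
  u ^ 2 + v ^ 2 = 1 -> pd3 (randers phi a b) x y u v = exp (phi x y) * u + a x y.
Proof.
  intros H. apply is_derive_unique. unfold randers.
  eapply is_derive_value.
  - auto_derive; [nra|reflexivity].
  - replace (u * (u * 1) + v * (v * 1)) with 1 by lra.
    rewrite sqrt_1. field.
Qed.

Lemma randers_pd4 (phi a b : R -> R -> R) (x y u v : R) :
  u ^ 2 + v ^ 2 = 1 -> pd4 (randers phi a b) x y u v = exp (phi x y) * v + b x y.
Proof.
  intros H. apply is_derive_unique. unfold randers.
  eapply is_derive_value.
  - auto_derive; [nra|reflexivity].
  - replace (u * (u * 1) + v * (v * 1)) with 1 by lra.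
    rewrite sqrt_1. field.
Qed.

Lemma randers_pd1 (M : R * R -> Prop) (phi a b : R -> R -> R) (x y u v : R) :
  smooth_on M phi -> smooth_on M a -> smooth_on M b -> M (x, y) -> u ^ 2 + v ^ 2 = 1 ->
  pd1 (randers phi a b) x y u v
  = exp (phi x y) * d_x phi x y + d_x a x y * u + d_x b x y * v.
Proof.
  intros Hphi Ha Hb Hxy H. apply is_derive_unique. unfold randers.
  assert (D1 := smooth_on_is_derive_x M phi x y Hphi Hxy).
  assert (D2 := smooth_on_is_derive_x M a x y Ha Hxy).
  assert (D3 := smooth_on_is_derive_x M b x y Hb Hxy).
  eapply is_derive_value.
  - auto_derive; [repeat split; eexists; eassumption|reflexivity].
  - rewrite (is_derive_unique (fun z : R => phi z y) _ _ D1),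
      (is_derive_unique (fun z : R => a z y) _ _ D2), (is_derive_unique (fun z : R => b z y) _ _ D3).
    replace (u * (u * 1) + v * (v * 1)) with 1 by lra.
    rewrite sqrt_1. ring.
Qed.

Lemma randers_pd2 (M : R * R -> Prop) (phi a b : R -> R -> R) (x y u v : R) :
  smooth_on M phi -> smooth_on M a -> smooth_on M b -> M (x, y) -> u ^ 2 + v ^ 2 = 1 ->
  pd2 (randers phi a b) x y u v
  = exp (phi x y) * d_y phi x y + d_y a x y * u + d_y b x y * v.
Proof.
  intros Hphi Ha Hb Hxy H. apply is_derive_unique. unfold randers.
  assert (D1 := smooth_on_is_derive_y M phi x y Hphi Hxy).
  assert (D2 := smooth_on_is_derive_y M a x y Ha Hxy).
  assert (D3 := smooth_on_is_derive_y M b x y Hb Hxy).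
  eapply is_derive_value.
  - auto_derive; [repeat split; eexists; eassumption|reflexivity].
  - rewrite (is_derive_unique (fun z : R => phi x z) _ _ D1),
      (is_derive_unique (fun z : R => a x z) _ _ D2), (is_derive_unique (fun z : R => b x z) _ _ D3).
    replace (u * (u * 1) + v * (v * 1)) with 1 by lra.
    rewrite sqrt_1. ring.
Qed.

(** The magnetic term of the geodesic equation: the exterior derivative of the 1-form,
    divided by the length element of the Riemannian part. *)
Definition magnetic (phi a b : R -> R -> R) (x y : R) : R :=
  exp (- phi x y) * (d_x b x y - d_y a x y).

Definition geodesic_curvature (phi a b : R -> R -> R) (x y th : R) : R :=
  d_y phi x y * cos th + - d_x phi x y * sin th + - magnetic phi a b x y.

Lemma smooth_on_magnetic (M : R * R -> Prop) (phi a b : R -> R -> R) :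
  open M -> smooth_on M phi -> smooth_on M a -> smooth_on M b ->
  smooth_on M (magnetic phi a b).
Proof.
  intros HM Hphi Ha Hb. apply elementary_smooth; [exact HM|].
  apply el_mult.
  - now apply el_exp, el_opp, el_smooth.
  - now apply el_minus; apply el_smooth; [apply smooth_on_d_x|apply smooth_on_d_y].
Qed.

Lemma is_derive_momentum (f g h : R -> R) (t f' g' h' : R) :
  is_derive f t f' -> is_derive g t g' -> is_derive h t h' ->
  is_derive (fun s => exp (f s) * g s + h s) t (exp (f t) * f' * g t + exp (f t) * g' + h').
Proof.
  intros H1 H2 H3. eapply is_derive_value.
  - auto_derive; [repeat split; eexists; eassumption|reflexivity].
  - rewrite (is_derive_unique (fun s : R => f s) _ _ H1),
      (is_derive_unique (fun s : R => g s) _ _ H2), (is_derive_unique (fun s : R => h s) _ _ H3).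
    ring.
Qed.

(** On unit vectors the Euler-Lagrange equations amount to the single equation prescribing
    the Euclidean curvature: their two components are its products with
    - e^phi sin th and e^phi cos th. *)
Lemma unit_speed_geodesic (M : R * R -> Prop) (phi a b : R -> R -> R) (X Y Th : R -> R) (r : R) :
  open M -> smooth_on M phi -> smooth_on M a -> smooth_on M b ->
  (forall t, Rabs t < r ->
     M (X t, Y t) /\ is_derive X t (cos (Th t)) /\ is_derive Y t (sin (Th t)) /\
     is_derive Th t (geodesic_curvature phi a b (X t) (Y t) (Th t))) ->
  geodesic M (randers phi a b) (- r) r X Y.
Proof.
  intros HM Hphi Ha Hb Hc t Ht.
  assert (Hin : forall s, - r < s < r -> Rabs s < r) by (intros; now apply Rabs_def1).
  assert (Hnear : locally t (fun s => - r < s < r)).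
  { apply Hin in Ht. rewrite <- (Rminus_0_r t) in Ht.
    generalize (locally_in_interval t 0 r Ht). apply filter_imp.
    intros s Hs. rewrite Rminus_0_r in Hs. apply Rabs_def2 in Hs. lra. }
  assert (Hw := smooth_on_magnetic M phi a b HM Hphi Ha Hb).
  set (ka := fun s => geodesic_curvature phi a b (X s) (Y s) (Th s)).
  assert (DX : forall s, - r < s < r -> Derive X s = cos (Th s)).
  { intros s Hs. apply is_derive_unique. now apply Hc, Hin. }
  assert (DY : forall s, - r < s < r -> Derive Y s = sin (Th s)).
  { intros s Hs. apply is_derive_unique. now apply Hc, Hin. }
  assert (Hlocal : forall (f g : R -> R) s, (forall s, - r < s < r -> f s = g s) ->
    - r < s < r -> locally s (fun z => g z = f z)).
  { intros f g s Hfg Hs. apply Hin in Hs. rewrite <- (Rminus_0_r s) in Hs.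
    generalize (locally_in_interval s 0 r Hs). apply filter_imp.
    intros z Hz. rewrite Rminus_0_r in Hz. apply Rabs_def2 in Hz. symmetry. apply Hfg. lra. }
  assert (DDX : forall s, - r < s < r -> is_derive (Derive X) s (- (sin (Th s) * ka s))).
  { intros s Hs. apply (is_derive_ext_loc (fun s => cos (Th s))).
    - now apply Hlocal.
    - destruct (Hc s (Hin s Hs)) as (_ & _ & _ & HT). eapply is_derive_value.
      + auto_derive; [eexists; eassumption|reflexivity].
      + rewrite (is_derive_unique (fun s : R => Th s) _ _ HT). unfold ka. ring. }
  assert (DDY : forall s, - r < s < r -> is_derive (Derive Y) s (cos (Th s) * ka s)).
  { intros s Hs. apply (is_derive_ext_loc (fun s => sin (Th s))).
    - now apply Hlocal.
    - destruct (Hc s (Hin s Hs)) as (_ & _ & _ & HT). eapply is_derive_value.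
      + auto_derive; [eexists; eassumption|reflexivity].
      + rewrite (is_derive_unique (fun s : R => Th s) _ _ HT). unfold ka. ring. }
  destruct (Hc t (Hin t Ht)) as (HMt & HX & HY & HT).
  assert (HTc : continuous Th t) by exact (is_derive_continuous _ _ _ HT).
  assert (Hcos : continuous (fun s => cos (Th s)) t)
    by (apply (continuous_comp Th cos); [exact HTc|apply continuous_cos]).
  assert (Hsin : continuous (fun s => sin (Th s)) t)
    by (apply (continuous_comp Th sin); [exact HTc|apply continuous_sin]).
  assert (Halong : forall f, smooth_on M f -> continuous (fun s => f (X s) (Y s)) t).
  { intros f Hf.
    exact (is_derive_continuous _ _ _ (is_derive_along_curve M f X Y t _ _ HM Hf HMt HX HY)). }
  assert (Hkac : continuous ka t).
  { unfold ka, geodesic_curvature.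
    apply (continuous_plus (V := R_NormedModule));
      [apply (continuous_plus (V := R_NormedModule))|].
    - apply (continuous_mult (K := R_AbsRing)); [|exact Hcos].
      now apply Halong, smooth_on_d_y.
    - apply (continuous_mult (K := R_AbsRing)); [|exact Hsin].
      apply (continuous_opp (V := R_NormedModule)). now apply (Halong (d_x phi)), smooth_on_d_x.
    - apply (continuous_opp (V := R_NormedModule)). now apply (Halong (magnetic phi a b)). }
  assert (Hcs : forall s, cos (Th s) ^ 2 + sin (Th s) ^ 2 = 1).
  { intros s. assert (H := sin2_cos2 (Th s)). unfold Rsqr in H. lra. }
  assert (Hexp : exp (phi (X t) (Y t)) * exp (- phi (X t) (Y t)) = 1)
    by (rewrite <- exp_plus, Rplus_opp_r; apply exp_0).
  assert (Kt : exp (phi (X t) (Y t)) * ka t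
    = exp (phi (X t) (Y t)) * (d_y phi (X t) (Y t) * cos (Th t) - d_x phi (X t) (Y t) * sin (Th t))
      - (d_x b (X t) (Y t) - d_y a (X t) (Y t))).
  { unfold ka, geodesic_curvature, magnetic.
    transitivity (exp (phi (X t) (Y t)) * (d_y phi (X t) (Y t) * cos (Th t)
      - d_x phi (X t) (Y t) * sin (Th t))
      - exp (phi (X t) (Y t)) * exp (- phi (X t) (Y t)) * (d_x b (X t) (Y t) - d_y a (X t) (Y t)));
      [ring|rewrite Hexp; ring]. }
  assert (Hphit := is_derive_along_curve M phi X Y t _ _ HM Hphi HMt HX HY).
  assert (Hat := is_derive_along_curve M a X Y t _ _ HM Ha HMt HX HY).
  assert (Hbt := is_derive_along_curve M b X Y t _ _ HM Hb HMt HX HY).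
  assert (F1 := Hcs t).
  assert (Dcos : is_derive (fun s => cos (Th s)) t (- (sin (Th t) * ka t))).
  { apply (is_derive_ext_loc (Derive X)); [|now apply DDX].
    revert Hnear. apply filter_imp. intros s Hs. now apply DX. }
  assert (Dsin : is_derive (fun s => sin (Th s)) t (cos (Th t) * ka t)).
  { apply (is_derive_ext_loc (Derive Y)); [|now apply DDY].
    revert Hnear. apply filter_imp. intros s Hs. now apply DY. }
  split; [|split; [|split; [|split]]].
  - split; [exact HMt|]. rewrite DX, DY by exact Ht. intros E. injection E as E1 E2.
    rewrite E1, E2 in F1. lra.
  - split; [eexists; exact HX|]. split; [eexists; exact (DDX t Ht)|].
    apply (continuous_ext_loc _ (fun s => - (sin (Th s) * ka s)) t).
    + apply (Hlocal _ (fun s => - (sin (Th s) * ka s))); [|exact Ht].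
      intros s Hs. apply is_derive_unique. now apply DDX.
    + apply (continuous_opp (V := R_NormedModule)).
      now apply (continuous_mult (K := R_AbsRing)).
  - split; [eexists; exact HY|]. split; [eexists; exact (DDY t Ht)|].
    apply (continuous_ext_loc _ (fun s => cos (Th s) * ka s) t).
    + apply (Hlocal _ (fun s => cos (Th s) * ka s)); [|exact Ht].
      intros s Hs. apply is_derive_unique. now apply DDY.
    + now apply (continuous_mult (K := R_AbsRing)).
  - rewrite (DX t Ht), (DY t Ht), (randers_pd1 M) by assumption.
    apply (is_derive_ext_loc (fun s => exp (phi (X s) (Y s)) * cos (Th s) + a (X s) (Y s))).
    + revert Hnear. apply filter_imp. intros s Hs.
      rewrite (DX s Hs), (DY s Hs), randers_pd3 by apply Hcs. reflexivity.
    + eapply is_derive_value.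
      * apply (is_derive_momentum _ (fun s => cos (Th s))); [exact Hphit|exact Dcos|exact Hat].
      * transitivity (exp (phi (X t) (Y t)) * (d_x phi (X t) (Y t) * cos (Th t)
          + d_y phi (X t) (Y t) * sin (Th t)) * cos (Th t)
          - (exp (phi (X t) (Y t)) * ka t) * sin (Th t)
          + d_x a (X t) (Y t) * cos (Th t) + d_y a (X t) (Y t) * sin (Th t)); [ring|].
        rewrite Kt.
        transitivity (exp (phi (X t) (Y t)) * d_x phi (X t) (Y t) * (cos (Th t) ^ 2 + sin (Th t) ^ 2)
          + d_x a (X t) (Y t) * cos (Th t) + d_x b (X t) (Y t) * sin (Th t)); [ring|].
        rewrite F1. ring.
  - rewrite (DX t Ht), (DY t Ht), (randers_pd2 M) by assumption.
    apply (is_derive_ext_loc (fun s => exp (phi (X s) (Y s)) * sin (Th s) + b (X s) (Y s))).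
    + revert Hnear. apply filter_imp. intros s Hs.
      rewrite (DX s Hs), (DY s Hs), randers_pd4 by apply Hcs. reflexivity.
    + eapply is_derive_value.
      * apply (is_derive_momentum _ (fun s => sin (Th s))); [exact Hphit|exact Dsin|exact Hbt].
      * transitivity (exp (phi (X t) (Y t)) * (d_x phi (X t) (Y t) * cos (Th t)
          + d_y phi (X t) (Y t) * sin (Th t)) * sin (Th t)
          + (exp (phi (X t) (Y t)) * ka t) * cos (Th t)
          + d_x b (X t) (Y t) * cos (Th t) + d_y b (X t) (Y t) * sin (Th t)); [ring|].
        rewrite Kt.
        transitivity (exp (phi (X t) (Y t)) * d_y phi (X t) (Y t) * (cos (Th t) ^ 2 + sin (Th t) ^ 2)
          + d_y a (X t) (Y t) * cos (Th t) + d_y b (X t) (Y t) * sin (Th t)); [ring|].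
        rewrite F1. ring.
Qed.

(** The curvature of the geodesic with given initial point and direction is constant, so
    its derivative at the starting point vanishes. *)
Lemma curvature_stationary (M : R * R -> Prop) (phi a b : R -> R -> R) (x y th : R) :
  open M -> smooth_on M phi -> smooth_on M a -> smooth_on M b ->
  only_circles_as_geodesics M (randers phi a b) -> M (x, y) ->
  (d_x (d_y phi) x y * cos th + d_y (d_y phi) x y * sin th) * cos th
  - (d_x (d_x phi) x y * cos th + d_y (d_x phi) x y * sin th) * sin th
  - (d_x (magnetic phi a b) x y * cos th + d_y (magnetic phi a b) x y * sin th)
  - geodesic_curvature phi a b x y th * (d_x phi x y * cos th + d_y phi x y * sin th) = 0.
Proof.
  intros HM Hphi Ha Hb Honly Hxy.
  assert (Hw := smooth_on_magnetic M phi a b HM Hphi Ha Hb).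
  assert (Hneg : forall f, smooth_on M f -> smooth_on M (fun x y => - f x y)).
  { intros f Hf. apply elementary_smooth; [exact HM|]. now apply el_opp, el_smooth. }
  assert (Hpx := smooth_on_d_x M phi Hphi). assert (Hpy := smooth_on_d_y M phi Hphi).
  destruct (prescribed_curvature M (d_y phi) (fun x y => - d_x phi x y)
    (fun x y => - magnetic phi a b x y) x y th HM Hpy (Hneg _ Hpx) (Hneg _ Hw) Hxy)
    as (X & Y & Th & r & Hr & X0 & Y0 & T0 & Hc).
  assert (Hg := unit_speed_geodesic M phi a b X Y Th r HM Hphi Ha Hb Hc).
  destruct (Honly (- r) r X Y ltac:(lra) Hg) as (C & HC & Hon).
  assert (H0 : Rabs 0 < r) by now rewrite Rabs_R0.
  destruct (Hc 0 H0) as (HM0 & HX & HY & HT).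
  eapply (circle_curvature_constant C X Y Th
    (fun t => geodesic_curvature phi a b (X t) (Y t) (Th t)) r); auto.
  - intros t Ht. apply Hon. apply Rabs_def2 in Ht. lra.
  - intros t Ht. destruct (Hc t Ht) as (_ & H1 & H2 & H3). auto.
  - eapply is_derive_value.
    + apply is_derive_frame.
      * now apply (is_derive_along_curve M (d_y phi)); [..|exact HX|exact HY].
      * apply (is_derive_opp (K := R_AbsRing) (V := R_NormedModule)).
        now apply (is_derive_along_curve M (d_x phi)); [..|exact HX|exact HY].
      * apply (is_derive_opp (K := R_AbsRing) (V := R_NormedModule)).
        now apply (is_derive_along_curve M (magnetic phi a b)); [..|exact HX|exact HY].
      * exact HT.
    + fold (geodesic_curvature phi a b (X 0) (Y 0) (Th 0)).
      unfold opp; simpl. rewrite X0, Y0, T0. ring.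
Qed.

(** The stationarity of the curvature is a trigonometric polynomial in the direction;
    its coefficients vanish. *)
Lemma circular_geodesics_equations (M : R * R -> Prop) (phi a b : R -> R -> R) (x y : R) :
  open M -> smooth_on M phi -> smooth_on M a -> smooth_on M b ->
  only_circles_as_geodesics M (randers phi a b) -> M (x, y) ->
  d_x (d_y phi) x y = d_x phi x y * d_y phi x y /\
  d_y (d_x phi) x y = d_x phi x y * d_y phi x y /\
  d_x (d_x phi) x y - d_x phi x y ^ 2 = d_y (d_y phi) x y - d_y phi x y ^ 2 /\
  d_x (magnetic phi a b) x y = magnetic phi a b x y * d_x phi x y /\
  d_y (magnetic phi a b) x y = magnetic phi a b x y * d_y phi x y.
Proof.
  intros HM Hphi Ha Hb Honly Hxy.
  assert (H := fun th => curvature_stationary M phi a b x y th HM Hphi Ha Hb Honly Hxy).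
  unfold geodesic_curvature in H.
  set (px := d_x phi x y) in *. set (py := d_y phi x y) in *.
  set (pxx := d_x (d_x phi) x y) in *. set (pyy := d_y (d_y phi) x y) in *.
  set (pxy := d_y (d_x phi) x y) in *. set (pyx := d_x (d_y phi) x y) in *.
  set (w := magnetic phi a b x y) in *.
  set (wx := d_x (magnetic phi a b) x y) in *. set (wy := d_y (magnetic phi a b) x y) in *.
  assert (E1 := H 0). rewrite cos_0, sin_0 in E1.
  assert (E2 := H PI). rewrite cos_PI, sin_PI in E2.
  assert (E3 := H (PI / 2)). rewrite cos_PI2, sin_PI2 in E3.
  assert (E4 := H (- (PI / 2))). rewrite cos_neg, sin_neg, cos_PI2, sin_PI2 in E4.
  assert (E5 := H (PI / 4)).
  assert (Hsq := sin2_cos2 (PI / 4)). unfold Rsqr in Hsq.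
  assert (Heq : sin (PI / 4) = cos (PI / 4)) by (rewrite cos_PI4, sin_PI4; reflexivity).
  rewrite Heq in E5, Hsq. set (h := cos (PI / 4)) in *.
  assert (F1 : pyx = px * py) by lra.
  assert (F2 : pxy = px * py) by lra.
  assert (F3 : wx = w * px) by lra.
  assert (F4 : wy = w * py) by lra.
  split; [exact F1|]. split; [exact F2|]. split; [|now split].
  rewrite F1, F2, F3, F4 in E5.
  assert (E6 : (h * h) * (pyy - pxx + px ^ 2 - py ^ 2) = 0).
  { rewrite <- E5. ring. }
  assert (Hh : h * h = 1 / 2) by lra. rewrite Hh in E6. lra.
Qed.

(** * Solution of the equations *)

Definition quadratic (A B C D x y : R) : R := A * (x ^ 2 + y ^ 2) + B * x + C * y + D.

Lemma d_x_exp_opp (N : R * R -> Prop) (phi : R -> R -> R) (x y : R) :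
  smooth_on N phi -> N (x, y) ->
  d_x (fun x y => exp (- phi x y)) x y = - d_x phi x y * exp (- phi x y).
Proof.
  intros Hphi Hxy. apply is_derive_unique.
  assert (D := smooth_on_is_derive_x N phi x y Hphi Hxy).
  eapply is_derive_value.
  - auto_derive; [eexists; exact D|reflexivity].
  - rewrite (is_derive_unique (fun z : R => phi z y) _ _ D). ring.
Qed.

Lemma d_y_exp_opp (N : R * R -> Prop) (phi : R -> R -> R) (x y : R) :
  smooth_on N phi -> N (x, y) ->
  d_y (fun x y => exp (- phi x y)) x y = - d_y phi x y * exp (- phi x y).
Proof.
  intros Hphi Hxy. apply is_derive_unique.
  assert (D := smooth_on_is_derive_y N phi x y Hphi Hxy).
  eapply is_derive_value.
  - auto_derive; [eexists; exact D|reflexivity].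
  - rewrite (is_derive_unique (fun z : R => phi x z) _ _ D). ring.
Qed.

Lemma d_x_mult (N : R * R -> Prop) (f g : R -> R -> R) (x y : R) :
  smooth_on N f -> smooth_on N g -> N (x, y) ->
  d_x (fun x y => f x y * g x y) x y = d_x f x y * g x y + f x y * d_x g x y.
Proof.
  intros Hf Hg Hxy. apply is_derive_unique.
  apply (is_derive_mult (fun z => f z y) (fun z => g z y)).
  - now apply (smooth_on_is_derive_x N).
  - now apply (smooth_on_is_derive_x N).
  - apply Rmult_comm.
Qed.

Lemma d_y_mult (N : R * R -> Prop) (f g : R -> R -> R) (x y : R) :
  smooth_on N f -> smooth_on N g -> N (x, y) ->
  d_y (fun x y => f x y * g x y) x y = d_y f x y * g x y + f x y * d_y g x y.
Proof.
  intros Hf Hg Hxy. apply is_derive_unique.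
  apply (is_derive_mult (fun z => f x z) (fun z => g x z)).
  - now apply (smooth_on_is_derive_y N).
  - now apply (smooth_on_is_derive_y N).
  - apply Rmult_comm.
Qed.

Lemma d_x_opp (f : R -> R -> R) (x y : R) : d_x (fun x y => - f x y) x y = - d_x f x y.
Proof. apply (Derive_opp (fun z => f z y)). Qed.

Lemma d_y_opp (f : R -> R -> R) (x y : R) : d_y (fun x y => - f x y) x y = - d_y f x y.
Proof. apply (Derive_opp (fun z => f x z)). Qed.

(** A function with mixed second derivative zero and equal pure second derivatives h has
    constant h, since h_x = mu_yyx = (mu_yx)_y and h_y = mu_xxy = (mu_xy)_x. *)
Lemma quadratic_of_hessian (N : R * R -> Prop) (mu : R -> R -> R) :
  open N -> connected N -> smooth_on N mu ->
  (forall x y, N (x, y) -> d_x (d_y mu) x y = 0 /\ d_x (d_x mu) x y = d_y (d_y mu) x y) ->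
  exists A B C D, forall x y, N (x, y) -> mu x y = quadratic A B C D x y.
Proof.
  intros HN Hcon Hmu H.
  destruct (classic (exists p, N p)) as [[[x0 y0] H0]|Hempty].
  2: { exists 0, 0, 0, 0. intros x y Hxy. exfalso. eauto. }
  assert (Hx := smooth_on_d_x N mu Hmu). assert (Hy := smooth_on_d_y N mu Hmu).
  assert (Hxx := smooth_on_d_x N _ Hx). assert (Hyy := smooth_on_d_y N _ Hy).
  assert (Hmix : forall x y, N (x, y) -> d_y (d_x mu) x y = 0).
  { intros x y Hxy. rewrite <- (smooth_on_mixed_partials N mu) by assumption. now apply H. }
  assert (HA : forall x y, N (x, y) -> d_x (d_x mu) x y = d_x (d_x mu) x0 y0).
  { intros x y Hxy. apply (connected_const N); auto. clear x y Hxy. intros x y Hxy. split.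
    - eapply is_derive_value; [now apply (smooth_on_is_derive_x N (d_x (d_x mu)))|].
      rewrite (d_x_ext_on N _ (d_y (d_y mu))) by (auto; intros; now apply H).
      rewrite (smooth_on_mixed_partials N (d_y mu)) by assumption.
      rewrite (d_y_ext_on N _ (fun _ _ => 0)) by (auto; intros; now apply H).
      apply (Derive_const 0).
    - eapply is_derive_value; [now apply (smooth_on_is_derive_y N (d_x (d_x mu)))|].
      rewrite <- (smooth_on_mixed_partials N (d_x mu)) by assumption.
      rewrite (d_x_ext_on N _ (fun _ _ => 0)) by auto.
      apply (Derive_const 0). }
  set (A := d_x (d_x mu) x0 y0 / 2).
  assert (HB : forall x y, N (x, y) -> d_x mu x y - 2 * A * x = d_x mu x0 y0 - 2 * A * x0).
  { intros x y Hxy. apply (connected_const N (fun x y => d_x mu x y - 2 * A * x)); auto.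
    clear x y Hxy. intros x y Hxy.
    assert (D1 := smooth_on_is_derive_x N _ x y Hx Hxy).
    assert (D2 := smooth_on_is_derive_y N _ x y Hx Hxy). split.
    - eapply is_derive_value; [auto_derive; [eexists; exact D1|reflexivity]|].
      rewrite (is_derive_unique (fun z : R => d_x mu z y) _ _ D1), HA by exact Hxy.
      unfold A. field.
    - eapply is_derive_value; [auto_derive; [eexists; exact D2|reflexivity]|].
      rewrite (is_derive_unique (fun z : R => d_x mu x z) _ _ D2), Hmix by exact Hxy. ring. }
  set (B := d_x mu x0 y0 - 2 * A * x0) in *.
  assert (HC : forall x y, N (x, y) -> d_y mu x y - 2 * A * y = d_y mu x0 y0 - 2 * A * y0).
  { intros x y Hxy. apply (connected_const N (fun x y => d_y mu x y - 2 * A * y)); auto.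
    clear x y Hxy. intros x y Hxy.
    assert (D1 := smooth_on_is_derive_x N _ x y Hy Hxy).
    assert (D2 := smooth_on_is_derive_y N _ x y Hy Hxy). destruct (H x y Hxy) as [E1 E2]. split.
    - eapply is_derive_value; [auto_derive; [eexists; exact D1|reflexivity]|].
      rewrite (is_derive_unique (fun z : R => d_y mu z y) _ _ D1), E1. ring.
    - eapply is_derive_value; [auto_derive; [eexists; exact D2|reflexivity]|].
      rewrite (is_derive_unique (fun z : R => d_y mu x z) _ _ D2), <- E2, HA by exact Hxy.
      unfold A. field. }
  set (C := d_y mu x0 y0 - 2 * A * y0) in *.
  exists A, B, C, (mu x0 y0 - quadratic A B C 0 x0 y0).
  intros x y Hxy.
  enough (E : mu x y - quadratic A B C 0 x y = mu x0 y0 - quadratic A B C 0 x0 y0).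
  { rewrite <- E. unfold quadratic. ring. }
  apply (connected_const N (fun x y => mu x y - quadratic A B C 0 x y)); auto.
  clear x y Hxy. intros x y Hxy. unfold quadratic.
  assert (D1 := smooth_on_is_derive_x N _ x y Hmu Hxy).
  assert (D2 := smooth_on_is_derive_y N _ x y Hmu Hxy). split.
  - eapply is_derive_value; [auto_derive; [eexists; exact D1|reflexivity]|].
    rewrite (is_derive_unique (fun z : R => mu z y) _ _ D1).
    assert (E := HB x y Hxy). lra.
  - eapply is_derive_value; [auto_derive; [eexists; exact D2|reflexivity]|].
    rewrite (is_derive_unique (fun z : R => mu x z) _ _ D2).
    assert (E := HC x y Hxy). lra.
Qed.

(** The equations say that mu = exp (- phi) has mu_xy = 0 and mu_xx = mu_yy, and that the
    gradient of the magnetic term times mu vanishes. *)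
Lemma circular_randers_structure (M N : R * R -> Prop) (phi a b : R -> R -> R) :
  open M -> smooth_on M phi -> smooth_on M a -> smooth_on M b ->
  only_circles_as_geodesics M (randers phi a b) ->
  open N -> (forall p, N p -> M p) -> connected N ->
  exists A B C D T, forall x y, N (x, y) ->
    exp (- phi x y) = quadratic A B C D x y /\
    (d_x b x y - d_y a x y) * exp (- phi x y) ^ 2 = T.
Proof.
  intros HM Hphi0 Ha0 Hb0 Honly HN HNM Hcon.
  assert (Heq := fun x y Hxy =>
    circular_geodesics_equations M phi a b x y HM Hphi0 Ha0 Hb0 Honly (HNM _ Hxy)).
  assert (Hw : smooth_on N (magnetic phi a b))
    by (apply (smooth_on_subset M); [exact HNM|now apply smooth_on_magnetic]).
  assert (Hphi : smooth_on N phi) by now apply (smooth_on_subset M).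
  clear Hphi0 Ha0 Hb0 Honly.
  set (mu := fun x y => exp (- phi x y)).
  assert (Hmu : smooth_on N mu)
    by (apply elementary_smooth; [exact HN|now apply el_exp, el_opp, el_smooth]).
  assert (Hx : smooth_on N (fun x y => - d_x phi x y))
    by (apply elementary_smooth; [exact HN|now apply el_opp, el_smooth, smooth_on_d_x]).
  assert (Hy : smooth_on N (fun x y => - d_y phi x y))
    by (apply elementary_smooth; [exact HN|now apply el_opp, el_smooth, smooth_on_d_y]).
  assert (Mx : forall x y, N (x, y) -> d_x mu x y = - d_x phi x y * mu x y)
    by (intros; now apply (d_x_exp_opp N)).
  assert (My : forall x y, N (x, y) -> d_y mu x y = - d_y phi x y * mu x y)
    by (intros; now apply (d_y_exp_opp N)).
  destruct (quadratic_of_hessian N mu HN Hcon Hmu) as (A & B & C & D & Hquad).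
  { intros x y Hxy. destruct (Heq x y Hxy) as (E1 & _ & E2 & _ & _). split.
    - rewrite (d_x_ext_on N _ (fun x y => - d_y phi x y * mu x y)) by auto.
      rewrite (d_x_mult N (fun x y => - d_y phi x y) mu), d_x_opp, Mx, E1 by assumption. ring.
    - rewrite (d_x_ext_on N _ (fun x y => - d_x phi x y * mu x y)) by auto.
      rewrite (d_y_ext_on N _ (fun x y => - d_y phi x y * mu x y)) by auto.
      rewrite (d_x_mult N (fun x y => - d_x phi x y) mu), d_x_opp, Mx by assumption.
      rewrite (d_y_mult N (fun x y => - d_y phi x y) mu), d_y_opp, My by assumption.
      replace (d_x (d_x phi) x y) with (d_y (d_y phi) x y - d_y phi x y ^ 2 + d_x phi x y ^ 2)
        by lra. ring. }
  assert (HT : exists T, forall x y, N (x, y) -> magnetic phi a b x y * mu x y = T).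
  { destruct (classic (exists p, N p)) as [[[x0 y0] H0]|Hempty].
    2: { exists 0. intros x y Hxy. exfalso. eauto. }
    exists (magnetic phi a b x0 y0 * mu x0 y0). intros x y Hxy.
    apply (connected_const N (fun x y => magnetic phi a b x y * mu x y)); auto.
    clear x y Hxy. intros x y Hxy. destruct (Heq x y Hxy) as (_ & _ & _ & E1 & E2).
    set (f := fun x y => magnetic phi a b x y * mu x y).
    assert (S : smooth_on N f)
      by (apply elementary_smooth; [exact HN|now apply el_mult; apply el_smooth]).
    split.
    - eapply is_derive_value; [now apply (smooth_on_is_derive_x N f)|].
      unfold f. rewrite (d_x_mult N), Mx, E1 by assumption. ring.
    - eapply is_derive_value; [now apply (smooth_on_is_derive_y N f)|].
      unfold f. rewrite (d_y_mult N), My, E2 by assumption. ring. }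
  destruct HT as [T HT].
  exists A, B, C, D, T. intros x y Hxy. split; [now apply Hquad|].
  rewrite <- (HT x y Hxy). unfold magnetic, mu. ring.
Qed.

(** * Curvature of conformally flat metrics *)

Lemma quadratic_derive_x (A B C D x y : R) :
  is_derive (fun z => quadratic A B C D z y) x (2 * A * x + B).
Proof. unfold quadratic. auto_derive; [trivial|ring]. Qed.

Lemma quadratic_derive_y (A B C D x y : R) :
  is_derive (fun z => quadratic A B C D x z) y (2 * A * y + C).
Proof. unfold quadratic. auto_derive; [trivial|ring]. Qed.

Lemma conformal_metric_derive (N : R * R -> Prop) (lam : R -> R -> R) (A B C D : R)
    (i j k : bool) (x y : R) :
  open N -> N (x, y) ->
  (forall x y, N (x, y) -> quadratic A B C D x y <> 0 /\ lam x y = / quadratic A B C D x y) ->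
  d_ i (conformal_metric lam j k) x y
  = if Bool.eqb j k
    then - 2 * (if i then 2 * A * y + C else 2 * A * x + B) / quadratic A B C D x y ^ 3
    else 0.
Proof.
  intros HN Hxy Hlam. destruct (Hlam x y Hxy) as [Hnz _].
  assert (Q1 := quadratic_derive_x A B C D x y). assert (Q2 := quadratic_derive_y A B C D x y).
  unfold conformal_metric. destruct (Bool.eqb j k).
  - destruct i; unfold d_.
    + rewrite (d_y_ext_on N _ (fun x y => (/ quadratic A B C D x y) ^ 2)); auto.
      2: { intros u v Huv. now rewrite (proj2 (Hlam u v Huv)). }
      apply is_derive_unique. eapply is_derive_value.
      * auto_derive; [split; [eexists; exact Q2|now split]|reflexivity].
      * rewrite (is_derive_unique (fun z : R => quadratic A B C D x z) _ _ Q2).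
        field. exact Hnz.
    + rewrite (d_x_ext_on N _ (fun x y => (/ quadratic A B C D x y) ^ 2)); auto.
      2: { intros u v Huv. now rewrite (proj2 (Hlam u v Huv)). }
      apply is_derive_unique. eapply is_derive_value.
      * auto_derive; [split; [eexists; exact Q1|now split]|reflexivity].
      * rewrite (is_derive_unique (fun z : R => quadratic A B C D z y) _ _ Q1).
        field. exact Hnz.
  - destruct i; apply (Derive_const 0).
Qed.

Lemma conformal_christoffel (N : R * R -> Prop) (lam : R -> R -> R) (A B C D : R)
    (k i j : bool) (x y : R) :
  open N -> N (x, y) ->
  (forall x y, N (x, y) -> quadratic A B C D x y <> 0 /\ lam x y = / quadratic A B C D x y) ->
  let m := fun i : bool => if i then 2 * A * y + C else 2 * A * x + B in
  christoffel (conformal_metric lam) k i j x y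
  = - ((if Bool.eqb k j then m i else 0) + (if Bool.eqb k i then m j else 0)
       - (if Bool.eqb i j then m k else 0)) / quadratic A B C D x y.
Proof.
  intros HN Hxy Hlam m. destruct (Hlam x y Hxy) as [Hnz E].
  unfold christoffel, sum2. rewrite !(conformal_metric_derive N lam A B C D) by assumption.
  unfold ginv, gdet, conformal_metric.
  destruct i, j, k; simpl; rewrite E; unfold m; field; exact Hnz.
Qed.

(** The metric (dx^2 + dy^2) / mu^2 has curvature mu (mu_xx + mu_yy) - mu_x^2 - mu_y^2,
    a constant for the quadratic polynomials mu considered here. *)
Lemma gauss_curvature_reciprocal_quadratic (N : R * R -> Prop) (lam : R -> R -> R)
    (A B C D x y : R) :
  open N -> N (x, y) ->
  (forall x y, N (x, y) -> quadratic A B C D x y <> 0 /\ lam x y = / quadratic A B C D x y) ->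
  gauss_curvature (conformal_metric lam) x y = 4 * A * D - B ^ 2 - C ^ 2.
Proof.
  intros HN Hxy Hlam. destruct (Hlam x y Hxy) as [Hnz E].
  assert (Q1 := quadratic_derive_x A B C D x y). assert (Q2 := quadratic_derive_y A B C D x y).
  assert (R1 : d_x (christoffel (conformal_metric lam) false true true) x y
    = (2 * A * quadratic A B C D x y - (2 * A * x + B) ^ 2) / quadratic A B C D x y ^ 2).
  { rewrite (d_x_ext_on N _ (fun x y => (2 * A * x + B) / quadratic A B C D x y)); auto.
    - apply is_derive_unique. eapply is_derive_value.
      + auto_derive; [split; [eexists; exact Q1|now split]|reflexivity].
      + rewrite (is_derive_unique (fun z : R => quadratic A B C D z y) _ _ Q1).
        field. exact Hnz.
    - intros u v Huv. rewrite (conformal_christoffel N lam A B C D) by assumption. simpl.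
      f_equal. ring. }
  assert (R2 : d_y (christoffel (conformal_metric lam) false false true) x y
    = - (2 * A * quadratic A B C D x y - (2 * A * y + C) ^ 2) / quadratic A B C D x y ^ 2).
  { rewrite (d_y_ext_on N _ (fun x y => - (2 * A * y + C) / quadratic A B C D x y)); auto.
    - apply is_derive_unique. eapply is_derive_value.
      + auto_derive; [split; [eexists; exact Q2|now split]|reflexivity].
      + rewrite (is_derive_unique (fun z : R => quadratic A B C D x z) _ _ Q2).
        field. exact Hnz.
    - intros u v Huv. rewrite (conformal_christoffel N lam A B C D) by assumption. simpl.
      f_equal. ring. }
  assert (R3 : riemann (conformal_metric lam) false false true true x y
    = (4 * A * D - B ^ 2 - C ^ 2) / quadratic A B C D x y ^ 2).
  { unfold riemann, sum2, d_. rewrite R1, R2.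
    rewrite !(conformal_christoffel N lam A B C D) by assumption. simpl.
    replace (4 * A * D - B * (B * 1) - C * (C * 1)) with
      (4 * A * quadratic A B C D x y - (2 * A * x + B) ^ 2 - (2 * A * y + C) ^ 2)
      by (unfold quadratic; ring).
    field. exact Hnz. }
  unfold gauss_curvature, sum2, gdet. rewrite R3.
  unfold conformal_metric at 1 2 4 5 6 7. simpl. rewrite E. field. exact Hnz.
Qed.

(** * Normal forms *)

Definition family_scale (g : geometry) : R := match g with flat => 1 | _ => 2 end.

(** With the curvature as a parameter the three families have one formula. *)
Definition family_denominator (g : geometry) (X Y : R) : R :=
  family_scale g * (1 + family_curvature g * (X ^ 2 + Y ^ 2)).

Lemma family_scale_pos (g : geometry) : 0 < family_scale g.
Proof. destruct g; simpl; lra. Qed.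

Lemma family_metric_eq (g : geometry) (tau X Y u v : R) :
  family_metric g tau X Y u v
  = / family_denominator g X Y * (sqrt (u ^ 2 + v ^ 2) + tau * (Y * u - X * v)).
Proof.
  unfold family_denominator. destruct g; cbn [family_metric family_scale family_curvature].
  - rewrite Rmult_0_l, Rplus_0_r, Rmult_1_l, Rinv_1. ring.
  - rewrite Rmult_1_l. unfold Rdiv. ring.
  - replace (1 + -1 * (X ^ 2 + Y ^ 2)) with (1 - (X ^ 2 + Y ^ 2)) by ring.
    unfold Rdiv. ring.
Qed.

Lemma family_domain_pos (g : geometry) (X Y : R) :
  0 < family_denominator g X Y -> family_domain g X Y.
Proof.
  unfold family_denominator. destruct g; simpl; trivial. intros H. lra.
Qed.

(** One-variable form of the two partial derivatives needed for the exterior derivative below. *)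
Lemma is_derive_family_form (K c eps : R) (p q P Q : R -> R) (t p' q' P' Q' : R) :
  c * (1 + eps * (p t ^ 2 + q t ^ 2)) <> 0 ->
  is_derive p t p' -> is_derive q t q' -> is_derive P t P' -> is_derive Q t Q' ->
  is_derive (fun z => K * / (c * (1 + eps * (p z ^ 2 + q z ^ 2))) * (q z * P z - p z * Q z)) t
    (K * (/ (c * (1 + eps * (p t ^ 2 + q t ^ 2)))
            * (q' * P t + q t * P' - p' * Q t - p t * Q')
          - 2 * c * eps * (p t * p' + q t * q') / (c * (1 + eps * (p t ^ 2 + q t ^ 2))) ^ 2
            * (q t * P t - p t * Q t))).
Proof.
  intros Hnz H1 H2 H3 H4. eapply is_derive_value.
  - auto_derive.
    + repeat split; try (eexists; eassumption). exact Hnz.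
    + reflexivity.
  - rewrite (is_derive_unique (fun s : R => p s) _ _ H1), (is_derive_unique (fun s : R => q s) _ _ H2),
      (is_derive_unique (fun s : R => P s) _ _ H3), (is_derive_unique (fun s : R => Q s) _ _ H4).
    assert (Hc : c <> 0) by (intros E; apply Hnz; rewrite E; ring).
    assert (Hd : 1 + eps * (p t ^ 2 + q t ^ 2) <> 0) by (intros E; apply Hnz; rewrite E; ring).
    field. repeat split; try exact Hc; intros E; apply Hd; rewrite <- E; ring.
Qed.

(** A coefficient of the linear part of the pulled back family metric: that of dx or dy,
    according to which partial derivatives of the map are taken for dm1 and dm2. *)
Definition family_form (g : geometry) (K : R) (m1 m2 dm1 dm2 : R -> R -> R) (x y : R) : R :=
  K * / family_denominator g (m1 x y) (m2 x y) * (m2 x y * dm1 x y - m1 x y * dm2 x y).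

Lemma smooth_on_family_form (N : R * R -> Prop) (g : geometry) (K : R)
    (m1 m2 dm1 dm2 : R -> R -> R) :
  open N -> smooth_on N m1 -> smooth_on N m2 -> smooth_on N dm1 -> smooth_on N dm2 ->
  (forall x y, N (x, y) -> family_denominator g (m1 x y) (m2 x y) <> 0) ->
  smooth_on N (family_form g K m1 m2 dm1 dm2).
Proof.
  intros HN H1 H2 H3 H4 Hnz. apply elementary_smooth; [exact HN|].
  apply el_mult; [apply el_mult; [apply el_const|apply el_inv; [|exact Hnz]]|].
  - apply el_mult; [apply el_const|]. apply el_plus; [apply el_const|].
    apply el_mult; [apply el_const|]. now apply el_plus; apply el_pow, el_smooth.
  - now apply el_minus; apply el_mult; apply el_smooth.
Qed.

(** The exterior derivative of the linear part of a family metric is a constant multiple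
    of the area form of its Riemannian part; under a map it pulls back with the Jacobian
    determinant. *)
Lemma family_form_exterior_derivative (N : R * R -> Prop) (g : geometry) (K : R)
    (m1 m2 : R -> R -> R) (x y : R) :
  open N -> smooth_on N m1 -> smooth_on N m2 -> N (x, y) ->
  family_denominator g (m1 x y) (m2 x y) <> 0 ->
  d_x (family_form g K m1 m2 (d_y m1) (d_y m2)) x y
  - d_y (family_form g K m1 m2 (d_x m1) (d_x m2)) x y
  = - 2 * family_scale g * K * (d_x m1 x y * d_y m2 x y - d_y m1 x y * d_x m2 x y)
    / family_denominator g (m1 x y) (m2 x y) ^ 2.
Proof.
  intros HN H1 H2 Hxy Hnz.
  eassert (E1 : d_x (family_form g K m1 m2 (d_y m1) (d_y m2)) x y = _).
  { apply is_derive_unique. unfold family_form, family_denominator.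
    apply (is_derive_family_form K (family_scale g) (family_curvature g)
      (fun z => m1 z y) (fun z => m2 z y) (fun z => d_y m1 z y) (fun z => d_y m2 z y) x).
    - exact Hnz.
    - now apply (smooth_on_is_derive_x N).
    - now apply (smooth_on_is_derive_x N).
    - now apply (smooth_on_is_derive_x N); [apply smooth_on_d_y|].
    - now apply (smooth_on_is_derive_x N); [apply smooth_on_d_y|]. }
  eassert (E2 : d_y (family_form g K m1 m2 (d_x m1) (d_x m2)) x y = _).
  { apply is_derive_unique. unfold family_form, family_denominator.
    apply (is_derive_family_form K (family_scale g) (family_curvature g)
      (fun z => m1 x z) (fun z => m2 x z) (fun z => d_x m1 x z) (fun z => d_x m2 x z) y).
    - exact Hnz.
    - now apply (smooth_on_is_derive_y N).
    - now apply (smooth_on_is_derive_y N).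
    - now apply (smooth_on_is_derive_y N); [apply smooth_on_d_x|].
    - now apply (smooth_on_is_derive_y N); [apply smooth_on_d_x|]. }
  rewrite E1, E2.
  rewrite (smooth_on_mixed_partials N m1), (smooth_on_mixed_partials N m2) by assumption.
  unfold family_denominator in *.
  set (c := family_scale g) in *. set (eps := family_curvature g) in *.
  set (p := m1 x y) in *. set (q := m2 x y) in *.
  set (px := d_x m1 x y). set (py := d_y m1 x y). set (qx := d_x m2 x y). set (qy := d_y m2 x y).
  assert (Hc : c <> 0) by (intros E; apply Hnz; rewrite E; ring).
  assert (Hd : 1 + eps * (p ^ 2 + q ^ 2) <> 0) by (intros E; apply Hnz; rewrite E; ring).
  field. now split.
Qed.

(** Here e = 1 or e = -1 according to the orientation character of the conformal map
    (m1, m2), and sg is its dilation. The Riemannian parts agree, and so do the exterior derivatives of the linear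
    parts for the right value of the parameter; closed forms being exact on simply
    connected sets, the metrics differ by a total derivative. *)
Lemma randers_normal_form (N : R * R -> Prop) (phi a b m1 m2 sg : R -> R -> R)
    (g : geometry) (k e T : R) :
  open N -> smooth_on N a -> smooth_on N b -> smooth_on N m1 -> smooth_on N m2 ->
  0 < k -> e ^ 2 = 1 ->
  (forall x y, N (x, y) ->
     0 < sg x y /\ d_x m1 x y = e * d_y m2 x y /\ d_y m1 x y = - e * d_x m2 x y /\
     d_x m1 x y ^ 2 + d_y m1 x y ^ 2 = sg x y ^ 2 /\
     k * sg x y * exp (- phi x y) = family_denominator g (m1 x y) (m2 x y) /\
     (d_x b x y - d_y a x y) * exp (- phi x y) ^ 2 = T) ->
  exists tau, forall U : R * R -> Prop,
    open U -> (forall p, U p -> N p) -> simply_connected U ->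
    exists psi : R -> R -> R,
      smooth_on U psi /\
      forall x y u v, slit_tangent U x y u v ->
        randers phi a b x y u v
        = k * pullback m1 m2 (family_metric g tau) x y u v + total_derivative psi x y u v.
Proof.
  intros HN Ha Hb H1 H2 Hk He H.
  assert (Hc := family_scale_pos g). set (c := family_scale g) in *.
  assert (Hden : forall x y, N (x, y) -> 0 < family_denominator g (m1 x y) (m2 x y)).
  { intros x y Hxy. destruct (H x y Hxy) as (Hs & _ & _ & _ & E & _). rewrite <- E.
    repeat apply Rmult_lt_0_compat; auto. apply exp_pos. }
  set (tau := - e * T * k / (2 * c)).
  set (at' := family_form g (k * tau) m1 m2 (d_x m1) (d_x m2)).
  set (bt' := family_form g (k * tau) m1 m2 (d_y m1) (d_y m2)).
  assert (Hnz : forall x y, N (x, y) -> family_denominator g (m1 x y) (m2 x y) <> 0)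
    by (intros x y Hxy; assert (Hp := Hden x y Hxy); lra).
  assert (Hat : smooth_on N at')
    by now apply smooth_on_family_form; [..|apply smooth_on_d_x|apply smooth_on_d_x|].
  assert (Hbt : smooth_on N bt')
    by now apply smooth_on_family_form; [..|apply smooth_on_d_y|apply smooth_on_d_y|].
  set (P := fun x y => a x y - at' x y). set (Q := fun x y => b x y - bt' x y).
  assert (HP : smooth_on N P)
    by (apply elementary_smooth; [exact HN|now apply el_minus; apply el_smooth]).
  assert (HQ : smooth_on N Q)
    by (apply elementary_smooth; [exact HN|now apply el_minus; apply el_smooth]).
  assert (Hclosed : forall x y, N (x, y) -> d_x Q x y = d_y P x y).
  { intros x y Hxy.
    assert (EQ : d_x Q x y = d_x b x y - d_x bt' x y).
    { apply is_derive_unique. apply (is_derive_minus (K := R_AbsRing) (V := R_NormedModule));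
        now apply (smooth_on_is_derive_x N). }
    assert (EP : d_y P x y = d_y a x y - d_y at' x y).
    { apply is_derive_unique. apply (is_derive_minus (K := R_AbsRing) (V := R_NormedModule));
        now apply (smooth_on_is_derive_y N). }
    assert (E := family_form_exterior_derivative N g (k * tau) m1 m2 x y HN H1 H2 Hxy (Hnz x y Hxy)).
    fold at' bt' c in E.
    destruct (H x y Hxy) as (Hs & C1 & C2 & C3 & C4 & C5).
    assert (Hmu := exp_pos (- phi x y)). set (mu := exp (- phi x y)) in *.
    assert (EJ : d_x m1 x y * d_y m2 x y - d_y m1 x y * d_x m2 x y = e * sg x y ^ 2).
    { rewrite <- C3.
      assert (X1 : d_y m2 x y = e * d_x m1 x y)
        by (rewrite C1; transitivity (e ^ 2 * d_y m2 x y); [rewrite He; ring|ring]).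
      assert (X2 : d_x m2 x y = - e * d_y m1 x y)
        by (rewrite C2; transitivity (e ^ 2 * d_x m2 x y); [rewrite He; ring|ring]).
      rewrite X1, X2. ring. }
    rewrite EJ, <- C4 in E.
    enough (E' : d_x bt' x y - d_y at' x y = d_x b x y - d_y a x y) by (rewrite EQ, EP; lra).
    rewrite E. transitivity (e ^ 2 * T / mu ^ 2).
    - unfold tau. field. repeat split; lra.
    - rewrite He, <- C5. field. lra. }
  exists tau. intros U HU HUN Hsc.
  destruct (poincare U P Q HU Hsc) as (psi & Hpsi & Hd).
  - now apply (smooth_on_subset N).
  - now apply (smooth_on_subset N).
  - intros x y Hxy. apply Hclosed, HUN, Hxy.
  - exists psi. split; [exact Hpsi|].
    intros x y u v [Hxy _]. destruct (Hd x y Hxy) as [D1 D2]. apply HUN in Hxy.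
    unfold total_derivative, pullback. rewrite D1, D2, family_metric_eq.
    unfold P, Q, at', bt', family_form.
    destruct (H x y Hxy) as (Hs & C1 & C2 & C3 & C4 & _).
    assert (Hmu := exp_pos (- phi x y)).
    assert (Hexp : exp (phi x y) = / exp (- phi x y))
      by (rewrite exp_Ropp, Rinv_inv; reflexivity).
    assert (Esq : sqrt ((d_x m1 x y * u + d_y m1 x y * v) ^ 2
      + (d_x m2 x y * u + d_y m2 x y * v) ^ 2) = sg x y * sqrt (u ^ 2 + v ^ 2)).
    { rewrite <- (sqrt_pow2 (sg x y)) by lra. rewrite <- sqrt_mult_alt by nra.
      f_equal. rewrite <- C3, C1, C2.
      transitivity ((e ^ 2 * d_y m2 x y ^ 2 + e ^ 2 * d_x m2 x y ^ 2) * (u ^ 2 + v ^ 2)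
        - (e ^ 2 - 1) * (d_x m2 x y * u + d_y m2 x y * v) ^ 2); [ring|].
      replace (e ^ 2 - 1) with 0 by lra. ring. }
    rewrite Esq. unfold randers. rewrite Hexp.
    rewrite <- C4. set (mu := exp (- phi x y)) in *. field. repeat split; lra.
Qed.

Definition equivalent_to_family (N : R * R -> Prop) (phi a b : R -> R -> R) : Prop :=
  exists (g : geometry) (tau k : R) (m : xplane -> xplane) (m1 m2 : R -> R -> R),
    0 < k /\
    moebius m /\
    smooth_on N m1 /\ smooth_on N m2 /\
    (forall x y, N (x, y) ->
       m (Some (x, y)) = Some (m1 x y, m2 x y) /\
       family_domain g (m1 x y) (m2 x y)) /\
    (forall U : R * R -> Prop,
       open U -> (forall p, U p -> N p) -> simply_connected U ->
       exists psi : R -> R -> R,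
         smooth_on U psi /\
         forall x y u v, slit_tangent U x y u v ->
           randers phi a b x y u v
           = k * pullback m1 m2 (family_metric g tau) x y u v
             + total_derivative psi x y u v).

Lemma similarity_normal_form (N : R * R -> Prop) (phi a b : R -> R -> R) (g : geometry)
    (s p q k T : R) :
  open N -> smooth_on N a -> smooth_on N b -> 0 < s -> 0 < k ->
  (forall x y, N (x, y) ->
     k * s * exp (- phi x y) = family_denominator g (s * x + p) (s * y + q) /\
     (d_x b x y - d_y a x y) * exp (- phi x y) ^ 2 = T) ->
  equivalent_to_family N phi a b.
Proof.
  intros HN Ha Hb Hs Hk H.
  set (m1 := fun x y : R => s * x + p). set (m2 := fun x y : R => s * y + q).
  assert (S1 : smooth_on N m1).
  { apply elementary_smooth; [exact HN|].
    apply el_plus; [apply el_mult; [apply el_const|apply el_x]|apply el_const]. }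
  assert (S2 : smooth_on N m2).
  { apply elementary_smooth; [exact HN|].
    apply el_plus; [apply el_mult; [apply el_const|apply el_y]|apply el_const]. }
  assert (D1 : forall x y, d_x m1 x y = s /\ d_y m1 x y = 0 /\ d_x m2 x y = 0 /\ d_y m2 x y = s).
  { intros x y. unfold m1, m2.
    repeat split; apply is_derive_unique; auto_derive; trivial; ring. }
  destruct (randers_normal_form N phi a b m1 m2 (fun _ _ => s) g k 1 T) as [tau Htau]; auto.
  - ring.
  - intros x y Hxy. destruct (H x y Hxy) as [E1 E2]. destruct (D1 x y) as (-> & -> & -> & ->).
    repeat split; try assumption; ring.
  - exists g, tau, k, (similarity s p q), m1, m2.
    split; [exact Hk|]. split; [now apply moebius_similarity|].
    split; [exact S1|]. split; [exact S2|]. split; [|exact Htau].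
    intros x y Hxy. split; [reflexivity|].
    apply family_domain_pos. destruct (H x y Hxy) as [E1 _]. unfold m1, m2. rewrite <- E1.
    repeat apply Rmult_lt_0_compat; auto. apply exp_pos.
Qed.

(** The map is an inversion about (p, q) followed by a similarity; it reverses the orientation
    and has dilation s over the squared distance to (p, q). *)
Lemma inversion_normal_form (N : R * R -> Prop) (phi a b : R -> R -> R) (g : geometry)
    (s p q t1 t2 k T : R) :
  open N -> smooth_on N a -> smooth_on N b -> 0 < s -> 0 < k ->
  (forall x y, N (x, y) ->
     (x - p) ^ 2 + (y - q) ^ 2 <> 0 /\
     k * (s / ((x - p) ^ 2 + (y - q) ^ 2)) * exp (- phi x y)
     = family_denominator g (s * ((x - p) / ((x - p) ^ 2 + (y - q) ^ 2)) + t1)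
         (s * ((y - q) / ((x - p) ^ 2 + (y - q) ^ 2)) + t2) /\
     (d_x b x y - d_y a x y) * exp (- phi x y) ^ 2 = T) ->
  equivalent_to_family N phi a b.
Proof.
  intros HN Ha Hb Hs Hk H.
  set (rho := fun x y => (x - p) ^ 2 + (y - q) ^ 2).
  set (m1 := fun x y => s * ((x - p) / rho x y) + t1).
  set (m2 := fun x y => s * ((y - q) / rho x y) + t2).
  assert (Hnz : forall x y, N (x, y) -> rho x y <> 0) by (intros x y Hxy; now apply H).
  assert (Hpos : forall x y, N (x, y) -> 0 < rho x y).
  { intros x y Hxy. assert (H0 := Hnz x y Hxy). unfold rho in *.
    assert (Q1 := pow2_ge_0 (x - p)). assert (Q2 := pow2_ge_0 (y - q)). lra. }
  assert (Erho : elementary N rho).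
  { apply el_plus; apply el_pow; apply el_minus; auto using el_x, el_y, el_const. }
  assert (S1 : smooth_on N m1).
  { apply elementary_smooth; [exact HN|]. apply el_plus; [|apply el_const].
    apply el_mult; [apply el_const|]. apply el_mult; [|now apply el_inv].
    apply el_minus; [apply el_x|apply el_const]. }
  assert (S2 : smooth_on N m2).
  { apply elementary_smooth; [exact HN|]. apply el_plus; [|apply el_const].
    apply el_mult; [apply el_const|]. apply el_mult; [|now apply el_inv].
    apply el_minus; [apply el_y|apply el_const]. }
  assert (D1 : forall x y, N (x, y) ->
    d_x m1 x y = s * ((y - q) ^ 2 - (x - p) ^ 2) / rho x y ^ 2 /\
    d_y m1 x y = - 2 * s * (x - p) * (y - q) / rho x y ^ 2 /\
    d_x m2 x y = - 2 * s * (x - p) * (y - q) / rho x y ^ 2 /\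
    d_y m2 x y = s * ((x - p) ^ 2 - (y - q) ^ 2) / rho x y ^ 2).
  { intros x y Hxy. assert (H0 := Hnz x y Hxy). unfold m1, m2. unfold rho in *.
    repeat split; apply is_derive_unique; auto_derive; try exact H0; field; exact H0. }
  destruct (randers_normal_form N phi a b m1 m2 (fun x y => s / rho x y) g k (-1) T)
    as [tau Htau]; auto.
  - ring.
  - intros x y Hxy. destruct (H x y Hxy) as (_ & E1 & E2).
    assert (H0 := Hnz x y Hxy). assert (Hp := Hpos x y Hxy).
    destruct (D1 x y Hxy) as (-> & -> & -> & ->).
    split; [now apply Rdiv_lt_0_compat|]. split; [field; exact H0|].
    split; [field; exact H0|]. split; [|split; [exact E1|exact E2]].
    transitivity (s ^ 2 * rho x y ^ 2 / rho x y ^ 4);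
      [unfold rho at 3; field; exact H0|field; exact H0].
  - exists g, tau, k,
      (fun P => similarity s t1 t2 (unit_inversion (similarity 1 (- p) (- q) P))), m1, m2.
    split; [exact Hk|]. split.
    { apply (moebius_compose (fun P => unit_inversion (similarity 1 (- p) (- q) P)));
        [|now apply moebius_similarity].
      apply moebius_compose; [apply moebius_similarity; lra|apply moebius_unit_inversion]. }
    split; [exact S1|]. split; [exact S2|]. split; [|exact Htau].
    intros x y Hxy. split.
    + cbn [similarity]. replace (1 * x + - p) with (x - p) by ring.
      replace (1 * y + - q) with (y - q) by ring. cbn [unit_inversion].
      destruct (Req_EM_T _ 0) as [E|_]; [now contradiction (Hnz x y Hxy)|reflexivity].
    + apply family_domain_pos. destruct (H x y Hxy) as (_ & E1 & _).
      unfold m1, m2, rho. rewrite <- E1. assert (Hp := Hpos x y Hxy).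
      repeat apply Rmult_lt_0_compat; auto; [|apply exp_pos].
      now apply Rinv_0_lt_compat.
Qed.

(** The set where the quadratic polynomial is positive, if nonempty, is the whole plane, or
    the plane without a point, or a half-plane, or the interior or exterior of a circle; it carries
    a flat, spherical or hyperbolic metric, which the similarity or inversion chosen in
    each case brings to the standard form. *)
Lemma quadratic_normal_form (N : R * R -> Prop) (phi a b : R -> R -> R) (A B C D T : R) :
  open N -> smooth_on N a -> smooth_on N b ->
  (forall x y, N (x, y) ->
     exp (- phi x y) = quadratic A B C D x y /\
     (d_x b x y - d_y a x y) * exp (- phi x y) ^ 2 = T) ->
  equivalent_to_family N phi a b.
Proof.
  intros HN Ha Hb H.
  destruct (classic (exists p, N p)) as [[[x0 y0] H0]|Hempty].
  2: { apply (similarity_normal_form N phi a b flat 1 0 0 1 T); auto; try lra.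
       intros x y Hxy. exfalso. eauto. }
  assert (Hpos : forall x y, N (x, y) -> 0 < quadratic A B C D x y).
  { intros x y Hxy. rewrite <- (proj1 (H x y Hxy)). apply exp_pos. }
  set (K := 4 * A * D - B ^ 2 - C ^ 2).
  destruct (Req_dec A 0) as [HA|HA].
  - destruct (Req_dec (B ^ 2 + C ^ 2) 0) as [HBC|HBC].
    + assert (HB : B = 0) by nra. assert (HC : C = 0) by nra.
      assert (HD : 0 < D).
      { assert (E := Hpos x0 y0 H0). unfold quadratic in E. rewrite HA, HB, HC in E. lra. }
      apply (similarity_normal_form N phi a b flat 1 0 0 (/ D) T); auto; try lra.
      * now apply Rinv_0_lt_compat.
      * intros x y Hxy. destruct (H x y Hxy) as [E1 E2]. split; [|exact E2].
        rewrite E1. unfold quadratic, family_denominator. simpl. rewrite HA, HB, HC. field. lra.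
    + (* The half-plane B x + C y + D > 0: the centre (p, q) of the inversion lies outside,
         at distance 1 from the boundary line. *)
      set (h := sqrt (B ^ 2 + C ^ 2)).
      assert (Hh : 0 < h) by (apply sqrt_lt_R0; nra).
      assert (Hh2 : B ^ 2 + C ^ 2 = h ^ 2) by (unfold h; rewrite pow2_sqrt; nra).
      set (p := - (1 + D / h) * (B / h)). set (q := - (1 + D / h) * (C / h)).
      assert (Hmu : forall x y, quadratic A B C D x y = B * (x - p) + C * (y - q) - h).
      { intros x y. unfold quadratic, p, q. rewrite HA.
        transitivity (B * x + C * y + (1 + D / h) * (B ^ 2 + C ^ 2) / h - h);
          [rewrite Hh2; field; lra|field; lra]. }
      apply (inversion_normal_form N phi a b hyperbolic 2 p q (- (B / h)) (- (C / h)) (4 / h) T);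
        auto; try lra.
      * apply Rdiv_lt_0_compat; lra.
      * intros x y Hxy. destruct (H x y Hxy) as [E1 E2]. assert (Hq := Hpos x y Hxy).
        rewrite Hmu in E1, Hq.
        assert (Hrho : (x - p) ^ 2 + (y - q) ^ 2 <> 0).
        { intros E. apply sum_squares_zero in E. destruct E as [Ex Ey].
          rewrite Ex, Ey in Hq. lra. }
        split; [exact Hrho|]. split; [|exact E2].
        rewrite E1. unfold family_denominator. cbn [family_scale family_curvature].
        set (X := x - p) in *. set (Y := y - q) in *.
        transitivity (2 * (1 - (4 * (X ^ 2 + Y ^ 2) / (X ^ 2 + Y ^ 2) ^ 2
          - 4 * (B * X + C * Y) / (h * (X ^ 2 + Y ^ 2)) + (B ^ 2 + C ^ 2) / h ^ 2))).
        -- rewrite Hh2. field. split; first [exact Hrho|lra].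
        -- field. split; first [exact Hrho|lra].
  - set (p := - B / (2 * A)). set (q := - C / (2 * A)).
    assert (Hmu : forall x y,
      quadratic A B C D x y = A * ((x - p) ^ 2 + (y - q) ^ 2) + K / (4 * A)).
    { intros x y. unfold quadratic, p, q, K. field. exact HA. }
    assert (HAmu : forall x y,
      A * quadratic A B C D x y = A ^ 2 * ((x - p) ^ 2 + (y - q) ^ 2) + K / 4)
      by (intros x y; rewrite Hmu; field; exact HA).
    destruct (Rtotal_order K 0) as [HK|[HK|HK]].
    + set (ka := sqrt (- K)).
      assert (Hka : 0 < ka) by (apply sqrt_lt_R0; lra).
      assert (HKka : K = - ka ^ 2) by (unfold ka; rewrite pow2_sqrt; lra).
      destruct (Rdichotomy A 0 HA) as [HAn|HAp].
      * (* The interior of a circle, rescaled to the unit disc. *)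
        set (s := - 2 * A / ka).
        assert (Hs : 0 < s) by (apply Rdiv_lt_0_compat; lra).
        apply (similarity_normal_form N phi a b hyperbolic s (- s * p) (- s * q) (4 / ka) T);
          auto; [apply Rdiv_lt_0_compat; lra|].
        intros x y Hxy. destruct (H x y Hxy) as [E1 E2]. split; [|exact E2].
        rewrite E1, Hmu, HKka. unfold family_denominator, s. simpl. field. split; lra.
      * (* The exterior of a circle, inverted at the centre onto the unit disc. *)
        set (s := ka / (2 * A)).
        assert (Hs : 0 < s) by (apply Rdiv_lt_0_compat; lra).
        apply (inversion_normal_form N phi a b hyperbolic s p q 0 0 (4 / ka) T);
          auto; [apply Rdiv_lt_0_compat; lra|].
        intros x y Hxy. destruct (H x y Hxy) as [E1 E2].
        assert (Hq := Hpos x y Hxy). assert (HAq := HAmu x y).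
        assert (Hrho : (x - p) ^ 2 + (y - q) ^ 2 <> 0).
        { intros E. rewrite E in HAq. nra. }
        split; [exact Hrho|]. split; [|exact E2].
        rewrite E1, Hmu, HKka. unfold family_denominator, s. simpl. field.
        split; [|split; lra]. intros E. apply Hrho. rewrite <- E. ring.
    + (* The plane without the point (p, q), where the polynomial vanishes. *)
      assert (HAp : 0 < A).
      { assert (Hq := Hpos x0 y0 H0). assert (HAq := HAmu x0 y0). rewrite HK in HAq.
        assert (Hnn := Rmult_le_pos _ _ (pow2_ge_0 A)
          (Rplus_le_le_0_compat _ _ (pow2_ge_0 (x0 - p)) (pow2_ge_0 (y0 - q)))).
        destruct (Rdichotomy A 0 HA) as [HAn|HAp]; [exfalso; nra|exact HAp]. }
      apply (inversion_normal_form N phi a b flat 1 p q 0 0 (/ A) T); auto; try lra.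
      { now apply Rinv_0_lt_compat. }
      intros x y Hxy. destruct (H x y Hxy) as [E1 E2].
      assert (Hq := Hpos x y Hxy). assert (HAq := HAmu x y).
      assert (Hrho : (x - p) ^ 2 + (y - q) ^ 2 <> 0).
      { intros E. rewrite E, HK in HAq. nra. }
      split; [exact Hrho|]. split; [|exact E2].
      rewrite E1, Hmu, HK. unfold family_denominator. simpl. field.
      split; [|lra]. intros E. apply Hrho. rewrite <- E. ring.
    + set (ka := sqrt K).
      assert (Hka : 0 < ka) by (apply sqrt_lt_R0; lra).
      assert (HKka : K = ka ^ 2) by (unfold ka; rewrite pow2_sqrt; lra).
      assert (HAp : 0 < A).
      { assert (Hq := Hpos x0 y0 H0). assert (HAq := HAmu x0 y0).
        assert (Hnn := Rmult_le_pos _ _ (pow2_ge_0 A)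
          (Rplus_le_le_0_compat _ _ (pow2_ge_0 (x0 - p)) (pow2_ge_0 (y0 - q)))).
        destruct (Rdichotomy A 0 HA) as [HAn|HAp]; [exfalso; nra|exact HAp]. }
      set (s := 2 * A / ka).
      assert (Hs : 0 < s) by (apply Rdiv_lt_0_compat; lra).
      apply (similarity_normal_form N phi a b spherical s (- s * p) (- s * q) (4 / ka) T);
        auto; [apply Rdiv_lt_0_compat; lra|].
      intros x y Hxy. destruct (H x y Hxy) as [E1 E2]. split; [|exact E2].
      rewrite E1, Hmu, HKka. unfold family_denominator, s. simpl. field. split; lra.
Qed.

Lemma family_factor_curvature (g : geometry) (x y : R) :
  family_domain g x y ->
  gauss_curvature (conformal_metric (fun x y => 4 * family_factor g x y)) x y
  = family_curvature g.
Proof.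
  intros Hxy. destruct g.
  - rewrite (gauss_curvature_reciprocal_quadratic (fun _ => True) _ 0 0 0 (/ 4)).
    + simpl. ring.
    + apply open_true.
    + trivial.
    + intros u v _. unfold quadratic. simpl. split; [lra|field].
  - rewrite (gauss_curvature_reciprocal_quadratic (fun _ => True) _ (/ 2) 0 0 (/ 2)).
    + simpl. field.
    + apply open_true.
    + trivial.
    + intros u v _. unfold quadratic. cbn [family_factor].
      assert (0 <= u ^ 2 + v ^ 2) by nra. split; [lra|field; lra].
  - rewrite (gauss_curvature_reciprocal_quadratic (fun z => fst z ^ 2 + snd z ^ 2 < 1)
      _ (- / 2) 0 0 (/ 2)).
    + simpl. field.
    + intros [u v] Huv. simpl in Huv.
      apply (proj1 (locally_2d_locally (fun u v => u ^ 2 + v ^ 2 < 1) u v)).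
      assert (Hc : continuity_2d_pt (fun u v => u ^ 2 + v ^ 2) u v).
      { apply (smooth_on_continuity (fun _ => True)); [|trivial].
        apply elementary_smooth; [apply open_true|].
        apply el_plus; apply el_pow; [apply el_x|apply el_y]. }
      assert (Hp : 0 < 1 - (u ^ 2 + v ^ 2)) by (simpl; lra).
      generalize (Hc (mkposreal _ Hp)). apply locally_2d_impl, locally_2d_forall.
      simpl. intros u' v' K. apply Rabs_def2 in K. lra.
    + exact Hxy.
    + intros u v Huv. cbn [fst snd] in Huv. unfold quadratic. cbn [family_factor].
      split; [lra|field; lra].
Qed.

Theorem mainTheorem1 :
  forall (M : R * R -> Prop) (phi a b : R -> R -> R),
    open M ->
    smooth_on M phi -> smooth_on M a -> smooth_on M b ->
    finsler M (randers phi a b) ->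
    only_circles_as_geodesics M (randers phi a b) ->
    (* on each connected open part N of M (on M itself when M is connected) *)
    (forall N : R * R -> Prop,
      open N -> (forall p, N p -> M p) -> connected N ->
      (exists K : R, forall x y, N (x, y) ->
         gauss_curvature (conformal_metric (fun x y => exp (phi x y))) x y = K) /\
      (exists (g : geometry) (tau k : R) (m : xplane -> xplane) (m1 m2 : R -> R -> R),
         0 < k /\
         moebius m /\
         smooth_on N m1 /\ smooth_on N m2 /\
         (forall x y, N (x, y) ->
            m (Some (x, y)) = Some (m1 x y, m2 x y) /\
            family_domain g (m1 x y) (m2 x y)) /\
         (* total derivatives: of a function on N itself when N is simply connected,
            and locally on N in general *)
         (forall U : R * R -> Prop,
            open U -> (forall p, U p -> N p) -> simply_connected U ->
            exists psi : R -> R -> R,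
              smooth_on U psi /\
              forall x y u v, slit_tangent U x y u v ->
                randers phi a b x y u v
                = k * pullback m1 m2 (family_metric g tau) x y u v
                  + total_derivative psi x y u v)))
    /\
    (* the Riemannian parts of the three families, rescaled by the constant 4,
       have curvature 0, 1 and -1 *)
    (forall (g : geometry) (x y : R), family_domain g x y ->
       gauss_curvature (conformal_metric (fun x y => 4 * family_factor g x y)) x y
       = family_curvature g).
Proof.
  intros M phi a b HM Hphi Ha Hb _ Honly. split; [|exact family_factor_curvature].
  intros N HN HNM Hcon.
  destruct (circular_randers_structure M N phi a b) as (A & B & C & D & T & H); auto.
  split.
  - exists (4 * A * D - B ^ 2 - C ^ 2). intros x y Hxy.
    apply (gauss_curvature_reciprocal_quadratic N); auto.
    clear x y Hxy. intros x y Hxy. destruct (H x y Hxy) as [E _]. rewrite <- E.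
    split; [apply Rgt_not_eq, exp_pos|]. now rewrite exp_Ropp, Rinv_inv.
  - apply (quadratic_normal_form N phi a b A B C D T); auto.
    + now apply (smooth_on_subset M).
    + now apply (smooth_on_subset M).
Qed.
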